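(* Let $K\to R$ be a homomorphism of commutative rings, and let $R\to S_l$, $1\le l\le n$, be a finite collection of homomorphisms of commutative rings such that the collection of induced maps of the spectra $\mathrm{Spec}\,S_l\to\mathrm{Spec}\,R$ is an affine open covering of the affine scheme $\mathrm{Spec}\,R$. Let $\alpha$ be an ordinal, $U$ be a contraadjusted $R$-module, and $V$ be an $R$-module. Let $D_l\colon\mathrm{Hom}_R(S_l,U)\to\mathrm{Hom}_R(S_l,V)$ be $K$-linear quite $S_l$-differential operators of ordinal order at most $\alpha$, defined for all indices $1\le l\le n$. For every pair of indices $j$ and $l$, put $S_{jl}=S_j\otimes_RS_l$. Assume that, for every pair of indices $j$ and $l$, the quite $S_{jl}$-differential operator $D_{jl}\colon\mathrm{Hom}_R(S_{jl},U)\to\mathrm{Hom}_R(S_{jl},V)$ induced by $D_j$ is equal (under the identification $S_{jl}\simeq S_{lj}$) to the quite $S_{lj}$-differential operator $D_{lj}\colon\mathrm{Hom}_R(S_{lj},U)\to\mathrm{Hom}_R(S_{lj},V)$ induced by $D_l$. Then there exists a unique $K$-linear quite $R$-differential operator $D\colon U\to V$ of ordinal order at most $\alpha$ such that, for every index $l$, the $S_l$-differential operator $D_l$ is induced by $D$.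
   Context: An $R$-module $C$ over a commutative ring $R$ is contraadjusted if $\mathrm{Ext}^1_R(R[r^{-1}],C)=0$ for every $r\in R$. For a homomorphism of commutative rings $K\to R$ and $R$-modules $U$, $V$, the group $E=\mathrm{Hom}_K(U,V)$ is an $R$-$R$-bimodule: $(re)(u)=r\,e(u)$, $(er)(u)=e(ru)$. Define $F_0E=\{e\in E\mid re-er=0\ \forall r\in R\}$ and $F_\alpha E=\{e\in E\mid re-er\in\bigcup_{\beta<\alpha}F_\beta E\ \forall r\in R\}$ for every ordinal $\alpha>0$. A $K$-linear map $e\colon U\to V$ is a $K$-linear quite $R$-differential operator of ordinal order at most $\alpha$ if $e\in F_\alpha E$; it is a quite $R$-differential operator if this holds for some ordinal $\alpha$. Induced operators: if $A\to A'$ is a flat epimorphism of commutative $K$-algebras (an epimorphism in commutative rings with $A'$ flat over $A$), $M$, $N$ are $A$-modules and $D\colon M\to N$ is a $K$-linear quite $A$-differential operator, then there is a unique $K$-linear quite $A'$-differential operator $D'\colon\mathrm{Hom}_A(A',M)\to\mathrm{Hom}_A(A',N)$ with $D'(g)(1)=D(g(1))$ for all $g\in\mathrm{Hom}_A(A',M)$; it is said to be induced by $D$. (Here $\mathrm{Hom}_A(A',M)$ is an $A'$-module via $(sg)(t)=g(st)$.) This is applied to $R\to S_l$ and to $S_l\to S_{jl}$, $S_j\to S_{jl}$, with the identifications $\mathrm{Hom}_{S_l}(S_{jl},\mathrm{Hom}_R(S_l,U))=\mathrm{Hom}_R(S_{jl},U)$, etc. An affine open covering means that every $\mathrm{Spec}\,S_l\to\mathrm{Spec}\,R$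 is an open immersion and the images cover $\mathrm{Spec}\,R$ (so $R\to S_l$ are flat epimorphisms). *)

(* Defs.v *)
From HB Require Import structures.
From mathcomp Require Import all_boot all_order all_algebra zify generic_quotient.
From mathcomp Require Import all_classical topology.

Set Implicit Arguments.
Unset Strict Implicit.
Unset Printing Implicit Defensive.

Import Order.TTheory GRing.Theory.
Local Open Scope classical_set_scope.
Local Open Scope quotient_scope.
Local Open Scope ring_scope.

(* The trivial ring has to be allowed: [S_j (x)_R S_l] vanishes when the
   corresponding open subschemes are disjoint, and so does [R[r^-1]] for
   nilpotent [r].  Hence [comPzRingType] rather than [comNzRingType]. *)

Definition restr (R S : pzRingType) (f : {rmorphism R -> S}) (M : lmodType S)
  : Type := M.

Section Restr.
Variables (R S : pzRingType) (f : {rmorphism R -> S}) (M : lmodType S).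

HB.instance Definition _ := GRing.Zmodule.on (restr f M).

Definition restr_scale (r : R) (m : restr f M) : restr f M :=
  (f r : S) *: (m : M).

Let restr_scaleA a b v :
  restr_scale a (restr_scale b v) = restr_scale (a * b) v.
Proof. by rewrite /restr_scale rmorphM scalerA. Qed.

Let restr_scale1 : left_id 1 restr_scale.
Proof. by move=> v; rewrite /restr_scale rmorph1 scale1r. Qed.

Let restr_scaleDr : right_distributive restr_scale +%R.
Proof. by move=> a u v; rewrite /restr_scale scalerDr. Qed.

Let restr_scaleDl v : {morph restr_scale^~ v : a b / a + b}.
Proof. by move=> a b; rewrite /restr_scale rmorphD scalerDl. Qed.

HB.instance Definition _ := GRing.Zmodule_isLmodule.Build R (restr f M)
  restr_scaleA restr_scale1 restr_scaleDr restr_scaleDl.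
End Restr.

Section Hom.
Variables (R S : comPzRingType) (f : {rmorphism R -> S}) (M : lmodType R).

Record is_hom (h : S -> M) : Prop := IsHom {
  is_homD : forall s t, h (s + t) = h s + h t;
  is_homZ : forall r t, h (f r * t) = r *: h t
}.

(* The [R]-linear maps [S -> M], where [R] acts on [S] through [f]. *)
Record homR := mk_hom { hom_fun :> S -> M; hom_is_hom : is_hom hom_fun }.
Implicit Types g h : homR.

Lemma homD h s t : h (s + t) = h s + h t.
Proof. exact: is_homD (hom_is_hom h) s t. Qed.

Lemma homZ h r t : h (f r * t) = r *: h t.
Proof. exact: is_homZ (hom_is_hom h) r t. Qed.

Lemma homP g h : (forall t, g t = h t) -> g = h.
Proof.
case: g h => [g gP] [h hP] /= gh.
have {}gh : g = h by apply/funext.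
by case: _ / gh in hP *; congr mk_hom; exact: Prop_irrelevance.
Qed.

HB.instance Definition _ := gen_eqMixin homR.
HB.instance Definition _ := gen_choiceMixin homR.

Let zero_is_hom : is_hom (fun=> 0).
Proof. by split=> *; rewrite ?addr0 ?scaler0. Qed.

Let add_is_hom g h : is_hom (fun t => g t + h t).
Proof. by split=> *; rewrite ?homD ?homZ ?scalerDr // addrACA. Qed.

Let opp_is_hom h : is_hom (fun t => - h t).
Proof. by split=> *; rewrite ?homD ?homZ ?scalerN // opprD. Qed.

Let scale_is_hom (s : S) h : is_hom (fun t => h (s * t)).
Proof. by split=> *; rewrite ?mulrDr ?homD // mulrCA homZ. Qed.

Definition hom_zero : homR := mk_hom zero_is_hom.
Definition hom_add g h : homR := mk_hom (add_is_hom g h).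
Definition hom_opp h : homR := mk_hom (opp_is_hom h).
Definition hom_scale s h : homR := mk_hom (scale_is_hom s h).

Let hom_addA : associative hom_add.
Proof. by move=> a b c; apply: homP => t; exact: addrA. Qed.

Let hom_addC : commutative hom_add.
Proof. by move=> a b; apply: homP => t; exact: addrC. Qed.

Let hom_add0 : left_id hom_zero hom_add.
Proof. by move=> a; apply: homP => t; exact: add0r. Qed.

Let hom_addN : left_inverse hom_zero hom_opp hom_add.
Proof. by move=> a; apply: homP => t; exact: addNr. Qed.

HB.instance Definition _ := GRing.isZmodule.Build homR
  hom_addA hom_addC hom_add0 hom_addN.

Let hom_scaleA a b v : hom_scale a (hom_scale b v) = hom_scale (a * b) v.
Proof.
by apply: homP => t; rewrite /= mulrA (mulrC b).
Qed.

Let hom_scale1 : left_id 1 hom_scale.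
Proof. by move=> v; apply: homP => t; rewrite /= -[in RHS](mul1r t). Qed.

Let hom_scaleDr : right_distributive hom_scale +%R.
Proof. by move=> a u v; apply: homP. Qed.

Let hom_scaleDl v : {morph hom_scale^~ v : a b / a + b}.
Proof.
move=> a b; apply: homP => t.
by rewrite -[LHS]/(v ((a + b) * t)) mulrDl homD.
Qed.

HB.instance Definition _ := GRing.Zmodule_isLmodule.Build S homR
  hom_scaleA hom_scale1 hom_scaleDr hom_scaleDl.

Lemma hom_addE g h t : (g + h) t = g t + h t. Proof. by []. Qed.
Lemma hom_scaleE s h t : (s *: h) t = h (s * t). Proof. by []. Qed.
End Hom.

Section Curry.
Variables (R A B : comPzRingType) (f : {rmorphism R -> A}).
Variables (i : {rmorphism A -> B}) (M : lmodType R).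

Let curry_inner (h : homR (i \o f) M) (t : B) :
  is_hom f (fun a : A => h (i a * t)).
Proof.
split=> [a b|r a]; first by rewrite rmorphD mulrDl homD.
by rewrite rmorphM -mulrA; exact: homZ.
Qed.

Let curry_outer (h : homR (i \o f) M) :
  is_hom i (fun t => mk_hom (curry_inner h t)).
Proof.
split=> [s t|a t]; apply: homP => b.
  by rewrite hom_addE /= mulrDr homD.
by rewrite hom_scaleE /= rmorphM mulrA (mulrC (i a)).
Qed.

Definition hom_curry (h : homR (i \o f) M) : homR i (homR f M) :=
  mk_hom (curry_outer h).

Let uncurry_is_hom (g : homR i (homR f M)) :
  is_hom (i \o f) (fun t => g t (1 : A)).
Proof.
split=> [s t|r t]; first by rewrite homD.
by rewrite /= homZ hom_scaleE mulr1 -[f r]mulr1 homZ.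
Qed.

Definition hom_uncurry (g : homR i (homR f M)) : homR (i \o f) M :=
  mk_hom (uncurry_is_hom g).

Lemma hom_curryE h t a : hom_curry h t a = h (i a * t).
Proof. by []. Qed.

Lemma hom_uncurryE g t : hom_uncurry g t = g t 1.
Proof. by []. Qed.

Lemma hom_curryK : cancel hom_curry hom_uncurry.
Proof.
by move=> h; apply: homP => t; rewrite hom_uncurryE hom_curryE rmorph1 mul1r.
Qed.

Lemma hom_uncurryK : cancel hom_uncurry hom_curry.
Proof.
move=> g; apply: homP => t; apply: homP => a.
by rewrite hom_curryE hom_uncurryE homZ hom_scaleE mulr1.
Qed.
End Curry.

Section Pull.
Variables (R B C : comPzRingType).
Variables (p : {rmorphism R -> B}) (q : {rmorphism R -> C}).
Variables (s : {rmorphism B -> C}) (sP : forall r, s (p r) = q r).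
Variable M : lmodType R.

Let pull_is_hom (h : homR q M) : is_hom p (fun t => h (s t)).
Proof.
by split=> [x y|r t]; rewrite ?rmorphD ?homD // rmorphM sP homZ.
Qed.

Definition hom_pull (h : homR q M) : homR p M := mk_hom (pull_is_hom h).
End Pull.

Section Localization.
Variables (R : comPzRingType) (r : R).
Implicit Types x y z : R * nat.

(* The pair [(a, n)] stands for the fraction [a / r ^+ n]. *)
Definition loc_rel x y : bool :=
  `[< exists k, r ^+ (k + y.2) * x.1 = r ^+ (k + x.2) * y.1 >].

Let loc_rel_equiv : equiv_class_of loc_rel.
Proof.
split=> [x|x y|y x z].
- by apply/asboolP; exists 0%N.
- by apply/asboolP/asboolP => -[k e]; exists k.
- move=> /asboolP[k e] /asboolP[l e']; apply/asboolP; exists (k + l + y.2)%N.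
  have -> : r ^+ (k + l + y.2 + z.2) * x.1 =
            r ^+ (l + z.2) * (r ^+ (k + y.2) * x.1).
    by rewrite mulrA -exprD; congr (r ^+ _ * _); lia.
  have -> : r ^+ (k + l + y.2 + x.2) * z.1 =
            r ^+ (k + x.2) * (r ^+ (l + y.2) * z.1).
    by rewrite mulrA -exprD; congr (r ^+ _ * _); lia.
  by rewrite e -e' !mulrA -!exprD addnC.
Qed.

Canonical loc_equiv := EquivRelPack loc_rel_equiv.

Definition loc : Type := {eq_quot loc_equiv}.
HB.instance Definition _ := Choice.on loc.
HB.instance Definition _ := Quotient.on loc.

Definition frac (a : R) (n : nat) : loc := \pi_loc (a, n).

Lemma fracP a m b n :
  frac a m = frac b n <-> exists k, r ^+ (k + n) * a = r ^+ (k + m) * b.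
Proof.
split=> [/eqP|e]; first by rewrite eqmodE => /asboolP.
by apply/eqP; rewrite eqmodE; apply/asboolP.
Qed.

Lemma loc_ind (P : loc -> Prop) : (forall a n, P (frac a n)) -> forall t, P t.
Proof. by move=> Pf; apply: quotW => -[a n]; exact: Pf. Qed.

Lemma frac_repr (x : loc) : frac (repr x).1 (repr x).2 = x.
Proof. by rewrite /frac -surjective_pairing reprK. Qed.

Lemma frac_expand k a n : frac a n = frac (r ^+ k * a) (k + n).
Proof. by apply/fracP; exists 0%N; rewrite mulrA -exprD; congr (r ^+ _ * _); lia. Qed.

Definition loc_add (x y : loc) : loc :=
  let: (a, m) := repr x in let: (b, n) := repr y in
  frac (r ^+ n * a + r ^+ m * b) (m + n).
Definition loc_opp (x : loc) : loc :=
  let: (a, m) := repr x in frac (- a) m.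
Definition loc_mul (x y : loc) : loc :=
  let: (a, m) := repr x in let: (b, n) := repr y in frac (a * b) (m + n).

Lemma frac_add a m b n :
  loc_add (frac a m) (frac b n) = frac (r ^+ n * a + r ^+ m * b) (m + n).
Proof.
rewrite /loc_add; have := frac_repr (frac a m); have := frac_repr (frac b n).
case: (repr (frac a m)) (repr (frac b n)) => [a' m'] [b' n'] /=.
move=> /fracP[l eb] /fracP[k ea]; apply/fracP; exists (k + l)%N.
rewrite !mulrDr; congr (_ + _).
  transitivity (r ^+ (l + n + n') * (r ^+ (k + m) * a')).
    by rewrite !mulrA -!exprD; congr (r ^+ _ * _); lia.
  by rewrite ea !mulrA -!exprD; congr (r ^+ _ * _); lia.
transitivity (r ^+ (k + m + m') * (r ^+ (l + n) * b')).
  by rewrite !mulrA -!exprD; congr (r ^+ _ * _); lia.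
by rewrite eb !mulrA -!exprD; congr (r ^+ _ * _); lia.
Qed.

Lemma frac_opp a m : loc_opp (frac a m) = frac (- a) m.
Proof.
rewrite /loc_opp; have := frac_repr (frac a m).
case: (repr (frac a m)) => [a' m'] /= /fracP[k e].
by apply/fracP; exists k; rewrite !mulrN e.
Qed.

Lemma frac_mul a m b n :
  loc_mul (frac a m) (frac b n) = frac (a * b) (m + n).
Proof.
rewrite /loc_mul; have := frac_repr (frac a m); have := frac_repr (frac b n).
case: (repr (frac a m)) (repr (frac b n)) => [a' m'] [b' n'] /=.
move=> /fracP[l eb] /fracP[k ea]; apply/fracP; exists (k + l)%N.
transitivity ((r ^+ (k + m) * a') * (r ^+ (l + n) * b')).
  by rewrite mulrACA -exprD; congr (r ^+ _ * _); lia.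
by rewrite ea eb mulrACA -exprD; congr (r ^+ _ * _); lia.
Qed.

Let loc_addA : associative loc_add.
Proof.
elim/loc_ind=> a m; elim/loc_ind=> b n; elim/loc_ind=> c p.
rewrite !frac_add addnA !mulrDr !mulrA -!exprD -addrA.
by rewrite (addnC p n) (addnC p m).
Qed.

Let loc_addC : commutative loc_add.
Proof.
by elim/loc_ind=> a m; elim/loc_ind=> b n; rewrite !frac_add addrC addnC.
Qed.

Let loc_add0 : left_id (frac 0 0) loc_add.
Proof.
by elim/loc_ind=> a m; rewrite !frac_add mulr0 add0r expr0 mul1r.
Qed.

Let loc_addN : left_inverse (frac 0 0) loc_opp loc_add.
Proof.
elim/loc_ind=> a m; rewrite frac_opp frac_add mulrN addNr.
by apply/fracP; exists 0%N; rewrite !mulr0.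
Qed.

HB.instance Definition _ := GRing.isZmodule.Build loc
  loc_addA loc_addC loc_add0 loc_addN.

Let loc_mulA : associative loc_mul.
Proof.
elim/loc_ind=> a m; elim/loc_ind=> b n; elim/loc_ind=> c p.
by rewrite !frac_mul mulrA addnA.
Qed.

Let loc_mulC : commutative loc_mul.
Proof.
by elim/loc_ind=> a m; elim/loc_ind=> b n; rewrite !frac_mul mulrC addnC.
Qed.

Let loc_mul1 : left_id (frac 1 0) loc_mul.
Proof. by elim/loc_ind=> a m; rewrite !frac_mul mul1r. Qed.

Let loc_mulDl : left_distributive loc_mul +%R.
Proof.
elim/loc_ind=> a m; elim/loc_ind=> b n; elim/loc_ind=> c p.
rewrite -[_ + _]/(loc_add _ _) -[X in _ = X]/(loc_add _ _).
rewrite !(frac_mul, frac_add) (frac_expand p); congr frac; last by lia.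
by rewrite mulrDl mulrDr !mulrA -!exprD (addnC p n) (addnC p m).
Qed.

HB.instance Definition _ := GRing.Zmodule_isComPzRing.Build loc
  loc_mulA loc_mulC loc_mul1 loc_mulDl.

Lemma fracD a m b n :
  frac a m + frac b n = frac (r ^+ n * a + r ^+ m * b) (m + n).
Proof. exact: frac_add. Qed.

Lemma fracM a m b n : frac a m * frac b n = frac (a * b) (m + n).
Proof. exact: frac_mul. Qed.

Definition loc_inj (a : R) : loc := frac a 0.

Let loc_inj_zmod : zmod_morphism loc_inj.
Proof.
move=> a b; rewrite /loc_inj -[- frac b 0]/(loc_opp _) frac_opp fracD.
by rewrite expr0 !mul1r.
Qed.

Let loc_inj_monoid : monoid_morphism loc_inj.
Proof. by split=> // a b; rewrite /loc_inj fracM. Qed.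

HB.instance Definition _ := GRing.isZmodMorphism.Build R loc loc_inj
  loc_inj_zmod.
HB.instance Definition _ := GRing.isMonoidMorphism.Build R loc loc_inj
  loc_inj_monoid.
End Localization.

Definition loc_map (R S : comPzRingType) (f : {rmorphism R -> S}) (r : R)
  (x : loc r) : loc (f r) := frac (f r) (f (repr x).1) (repr x).2.

Lemma loc_mapE (R S : comPzRingType) (f : {rmorphism R -> S}) (r a : R) n :
  loc_map f (frac r a n) = frac (f r) (f a) n.
Proof.
rewrite /loc_map; have := frac_repr (frac r a n).
case: (repr (frac r a n)) => [a' n'] /= /fracP[k e].
by apply/fracP; exists k; rewrite -!rmorphXn -!rmorphM e.
Qed.

Section Ext.
Variables (R : comPzRingType) (M C : lmodType R).

Record extension := Extension {
  ext_mod : lmodType R;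
  ext_in : {linear C -> ext_mod};
  ext_out : {linear ext_mod -> M};
  ext_in_inj : injective ext_in;
  ext_out_surj : forall m, exists e, ext_out e = m;
  ext_exact : forall e, ext_out e = 0 <-> exists c, ext_in c = e
}.

(* By the five lemma such an [h] is automatically bijective. *)
Definition ext_equiv (X Y : extension) : Prop :=
  exists h : {linear ext_mod X -> ext_mod Y},
    (forall c, h (ext_in X c) = ext_in Y c) /\
    (forall e, ext_out Y (h e) = ext_out X e).

Definition split_in (c : C) : C * M := (c, 0).
Definition split_out (e : C * M) : M := e.2.

Let split_in_linear : linear split_in.
Proof.
by move=> a u v; rewrite /split_in; congr pair; rewrite /= scaler0 addr0.
Qed.
Let split_out_linear : linear split_out. Proof. by []. Qed.
HB.instance Definition _ := GRing.isLinear.Build R C (C * M)%type _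
  split_in split_in_linear.
HB.instance Definition _ := GRing.isLinear.Build R (C * M)%type M _
  split_out split_out_linear.

Let split_in_inj : injective split_in. Proof. by move=> u v []. Qed.
Let split_out_surj m : exists e, split_out e = m. Proof. by exists (0, m). Qed.
Let split_exact e : split_out e = 0 <-> exists c, split_in c = e.
Proof.
case: e => c m; split=> [/= e|[d [_ <-]] //].
by exists c; rewrite /split_in -e.
Qed.

Definition split_extension : extension :=
  @Extension (C * M)%type split_in split_out
    split_in_inj split_out_surj split_exact.

(* [Ext^1_R(M, C)] is the group of equivalence classes of extensions, whose
   zero element is the class of the split extension. *)
Definition Ext1_vanishes : Prop :=
  forall X : extension, ext_equiv X split_extension.
End Ext.

Definition contraadjusted (R : comPzRingType) (C : lmodType R) : Prop :=
  forall r : R, Ext1_vanishes (restr (@loc_inj R r) (loc r)^o) C.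

Section Tensor.
Variables (R A B : comPzRingType).
Variables (f : {rmorphism R -> A}) (g : {rmorphism R -> B}).

Record balanced (W : zmodType) (b : A -> B -> W) : Prop := Balanced {
  balancedDl : forall x y c, b (x + y) c = b x c + b y c;
  balancedDr : forall x c d, b x (c + d) = b x c + b x d;
  balancedM : forall r x c, b (f r * x) c = b x (g r * c)
}.

Implicit Types x y z : seq (A * B).

Definition bsum (W : zmodType) (b : A -> B -> W) x : W :=
  \sum_(p <- x) b p.1 p.2.

(* A list of pairs stands for the corresponding sum of pure tensors; two lists
   are identified when no balanced biadditive map distinguishes them.  This is
   the quotient of the free abelian group on [A * B] by the usual relations:
   see [tens_univ] and [tens_univ_unique] for the universal property. *)
Definition tens_rel x y : bool :=
  `[< forall (W : zmodType) (b : A -> B -> W), balanced b ->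
        bsum b x = bsum b y >].

Let tens_rel_equiv : equiv_class_of tens_rel.
Proof.
split=> [x|x y|y x z].
- by apply/asboolP.
- by apply/asboolP/asboolP => e W b hb; rewrite e.
- by move=> /asboolP e /asboolP e'; apply/asboolP => W b hb; rewrite e ?e'.
Qed.

Canonical tens_equiv := EquivRelPack tens_rel_equiv.

Definition tens : Type := {eq_quot tens_equiv}.
HB.instance Definition _ := Choice.on tens.
HB.instance Definition _ := Quotient.on tens.

Definition tsum x : tens := \pi_tens x.

Lemma tsumP x y : tsum x = tsum y <->
  forall (W : zmodType) (b : A -> B -> W), balanced b -> bsum b x = bsum b y.
Proof.
split=> [/eqP|e]; first by rewrite eqmodE => /asboolP.
by apply/eqP; rewrite eqmodE; apply/asboolP.
Qed.

Lemma tsum_ind (P : tens -> Prop) : (forall x, P (tsum x)) -> forall t, P t.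
Proof. by move=> Pt; apply: quotW. Qed.

Lemma tsum_repr t : tsum (repr t) = t.
Proof. exact: reprK. Qed.

Let negs x := [seq (- p.1, p.2) | p <- x].
Let mulp (p q : A * B) : A * B := (p.1 * q.1, p.2 * q.2).
Let muls x y := [seq mulp p q | p <- x, q <- y].

Section Balanced.
Variables (W : zmodType) (b : A -> B -> W) (hb : balanced b).

Lemma balanced0l c : b 0 c = 0.
Proof. by apply: (addrI (b 0 c)); rewrite -(balancedDl hb) !addr0. Qed.

Lemma balancedNl a c : b (- a) c = - b a c.
Proof.
by apply: (addrI (b a c)); rewrite -(balancedDl hb) !subrr balanced0l.
Qed.

Lemma bsum_cat x y : bsum b (x ++ y) = bsum b x + bsum b y.
Proof. by rewrite /bsum big_cat. Qed.

Let bsum_negs x : bsum b (negs x) = - bsum b x.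
Proof.
rewrite /bsum big_map -sumrN; apply: eq_bigr => p _; exact: balancedNl.
Qed.

Let bsum_muls x y :
  bsum b (muls x y) = bsum (fun a c => bsum (fun a' c' => b (a * a') (c * c')) y) x.
Proof. by rewrite /bsum /muls big_allpairs_dep. Qed.

Let bsum_mulsr x y :
  bsum b (muls x y) = bsum (fun a c => bsum (fun a' c' => b (a' * a) (c' * c)) x) y.
Proof. by rewrite bsum_muls /bsum exchange_big. Qed.

Let balanced_mull y :
  balanced (fun a c => bsum (fun a' c' => b (a * a') (c * c')) y).
Proof.
split=> [u v c|u c d|r u c]; rewrite /bsum -?big_split;
  apply: eq_bigr => p _ /=.
- by rewrite mulrDl balancedDl.
- by rewrite mulrDl balancedDr.
- by rewrite -!mulrA balancedM.
Qed.

Let balanced_mulr x :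
  balanced (fun a c => bsum (fun a' c' => b (a' * a) (c' * c)) x).
Proof.
split=> [u v c|u c d|r u c]; rewrite /bsum -?big_split;
  apply: eq_bigr => p _ /=.
- by rewrite mulrDr balancedDl.
- by rewrite mulrDr balancedDr.
- by rewrite [_ * (f r * _)]mulrCA [_ * (g r * _)]mulrCA balancedM.
Qed.

Lemma bsum_negs_eq x y : tsum x = tsum y -> bsum b (negs x) = bsum b (negs y).
Proof. by move=> /tsumP e; rewrite !bsum_negs e. Qed.

Lemma bsum_muls_eq x x' y y' : tsum x = tsum x' -> tsum y = tsum y' ->
  bsum b (muls x y) = bsum b (muls x' y').
Proof.
move=> /tsumP ex /tsumP ey.
rewrite bsum_muls (ex _ _ (balanced_mull y)) -bsum_muls.
by rewrite bsum_mulsr (ey _ _ (balanced_mulr x')) -bsum_mulsr.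
Qed.

Lemma bsum_negs_cat x : bsum b (negs x ++ x) = 0.
Proof. by rewrite bsum_cat bsum_negs addNr. Qed.
End Balanced.

Definition tens_add (s t : tens) : tens := tsum (repr s ++ repr t).
Definition tens_opp (t : tens) : tens := tsum [seq (- p.1, p.2) | p <- repr t].
Definition tens_mul (s t : tens) : tens :=
  tsum [seq (p.1 * q.1, p.2 * q.2) | p <- repr s, q <- repr t].

Lemma tsum_add x y : tens_add (tsum x) (tsum y) = tsum (x ++ y).
Proof.
apply/tsumP => W b hb; rewrite !bsum_cat.
by congr (_ + _); apply: (iffLR (tsumP _ _)) hb; exact: tsum_repr.
Qed.

Lemma tsum_opp x : tens_opp (tsum x) = tsum [seq (- p.1, p.2) | p <- x].
Proof. by apply/tsumP => W b hb; apply/bsum_negs_eq/tsum_repr. Qed.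

Lemma tsum_mul x y : tens_mul (tsum x) (tsum y) =
  tsum [seq (p.1 * q.1, p.2 * q.2) | p <- x, q <- y].
Proof. by apply/tsumP => W b hb; apply/bsum_muls_eq; rewrite ?tsum_repr. Qed.

Let tens_addA : associative tens_add.
Proof.
elim/tsum_ind=> x; elim/tsum_ind=> y; elim/tsum_ind=> z.
by rewrite !tsum_add catA.
Qed.

Let tens_addC : commutative tens_add.
Proof.
elim/tsum_ind=> x; elim/tsum_ind=> y; rewrite !tsum_add.
by apply/tsumP => W b hb; rewrite !bsum_cat addrC.
Qed.

Let tens_add0 : left_id (tsum [::]) tens_add.
Proof. by elim/tsum_ind=> x; rewrite tsum_add. Qed.

Let tens_addN : left_inverse (tsum [::]) tens_opp tens_add.
Proof.
elim/tsum_ind=> x; rewrite tsum_opp tsum_add; apply/tsumP => W b hb.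
by rewrite bsum_negs_cat // /bsum big_nil.
Qed.

HB.instance Definition _ := GRing.isZmodule.Build tens
  tens_addA tens_addC tens_add0 tens_addN.

Let bsum_mulE (W : zmodType) (b : A -> B -> W) x y :
  bsum b [seq (p.1 * q.1, p.2 * q.2) | p <- x, q <- y] =
  \sum_(p <- x) \sum_(q <- y) b (p.1 * q.1) (p.2 * q.2).
Proof. by rewrite /bsum big_allpairs_dep. Qed.

Let tens_mulA : associative tens_mul.
Proof.
elim/tsum_ind=> x; elim/tsum_ind=> y; elim/tsum_ind=> z.
rewrite !tsum_mul; apply/tsumP => W b hb; rewrite !bsum_mulE big_allpairs_dep.
apply: eq_bigr => p _; rewrite big_allpairs_dep; apply: eq_bigr => q _.
by apply: eq_bigr => s _; rewrite /= !mulrA.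
Qed.

Let tens_mulC : commutative tens_mul.
Proof.
elim/tsum_ind=> x; elim/tsum_ind=> y.
rewrite !tsum_mul; apply/tsumP => W b hb; rewrite !bsum_mulE exchange_big.
apply: eq_bigr => p _; apply: eq_bigr => q _.
by rewrite /= mulrC (mulrC q.2).
Qed.

Let tens_mul1 : left_id (tsum [:: (1, 1)]) tens_mul.
Proof.
elim/tsum_ind=> x; rewrite tsum_mul; apply/tsumP => W b hb.
rewrite bsum_mulE big_seq1; apply: eq_bigr => p _.
by rewrite !mul1r.
Qed.

Let tens_mulDl : left_distributive tens_mul +%R.
Proof.
elim/tsum_ind=> x; elim/tsum_ind=> y; elim/tsum_ind=> z.
rewrite -[_ + _]/(tens_add _ _) -[X in _ = X]/(tens_add _ _).
rewrite !(tsum_mul, tsum_add); apply/tsumP => W b hb.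
by rewrite bsum_cat !bsum_mulE big_cat.
Qed.

HB.instance Definition _ := GRing.Zmodule_isComPzRing.Build tens
  tens_mulA tens_mulC tens_mul1 tens_mulDl.

Definition pure (a : A) (c : B) : tens := tsum [:: (a, c)].

Lemma pure_balanced : balanced pure.
Proof.
split=> [a a' c|a c c'|r a c].
- rewrite -[X in _ = X]/(tens_add _ _) tsum_add; apply/tsumP => W b hb.
  by rewrite /bsum !(big_cons, big_nil) !addr0 /= balancedDl.
- rewrite -[X in _ = X]/(tens_add _ _) tsum_add; apply/tsumP => W b hb.
  by rewrite /bsum !(big_cons, big_nil) !addr0 /= balancedDr.
- apply/tsumP => W b hb.
  by rewrite /bsum !big_seq1 /= balancedM.
Qed.

Lemma pureM a c a' c' : pure a c * pure a' c' = pure (a * a') (c * c').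
Proof. exact: tsum_mul. Qed.

Lemma tsumE x : tsum x = \sum_(p <- x) pure p.1 p.2.
Proof.
elim: x => [|p x IH]; first by rewrite big_nil.
rewrite big_cons -IH -[X in _ = X]/(tens_add _ _) tsum_add.
by case: p.
Qed.

Definition tens_lift (W : zmodType) (b : A -> B -> W) (t : tens) : W :=
  bsum b (repr t).

Lemma tens_univ (W : zmodType) (b : A -> B -> W) : balanced b ->
  zmod_morphism (tens_lift b) /\ forall a c, tens_lift b (pure a c) = b a c.
Proof.
move=> hb; have liftE x : tens_lift b (tsum x) = bsum b x.
  by apply: (iffLR (tsumP _ _)) hb; exact: tsum_repr.
split; last by move=> a c; rewrite liftE /bsum big_seq1.
elim/tsum_ind=> x; elim/tsum_ind=> y.
rewrite -[_ - _]/(tens_add _ (tens_opp _)) tsum_opp tsum_add !liftE bsum_cat.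
congr (_ + _); rewrite /bsum big_map -sumrN; apply: eq_bigr => p _.
exact: balancedNl.
Qed.

Lemma tens_univ_unique (W : zmodType) (h h' : tens -> W) :
  zmod_morphism h -> zmod_morphism h' ->
  (forall a c, h (pure a c) = h' (pure a c)) -> h =1 h'.
Proof.
move=> hM hM' hh'; elim/tsum_ind=> x; rewrite tsumE.
pose mh := GRing.isZmodMorphism.Build tens W h hM.
pose mh' := GRing.isZmodMorphism.Build tens W h' hM'.
pose H : {additive tens -> W} := HB.pack h mh.
pose H' : {additive tens -> W} := HB.pack h' mh'.
rewrite -[h _]/(H _) -[h' _]/(H' _) !raddf_sum; apply: eq_bigr => p _.
exact: hh'.
Qed.

Definition tensl (a : A) : tens := pure a 1.
Definition tensr (c : B) : tens := pure 1 c.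

Let tensl_zmod : zmod_morphism tensl.
Proof.
move=> a a'; rewrite /tensl (balancedDl pure_balanced).
by rewrite (balancedNl pure_balanced).
Qed.

Let tensl_monoid : monoid_morphism tensl.
Proof. by split=> // a a'; rewrite /tensl pureM mulr1. Qed.

HB.instance Definition _ := GRing.isZmodMorphism.Build A tens tensl tensl_zmod.
HB.instance Definition _ :=
  GRing.isMonoidMorphism.Build A tens tensl tensl_monoid.

Let tensr_zmod : zmod_morphism tensr.
Proof.
move=> c c'; apply/eqP; rewrite eq_sym subr_eq /tensr.
by rewrite -(balancedDr pure_balanced) subrK.
Qed.

Let tensr_monoid : monoid_morphism tensr.
Proof. by split=> // c c'; rewrite /tensr pureM mulr1. Qed.

HB.instance Definition _ := GRing.isZmodMorphism.Build B tens tensr tensr_zmod.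
HB.instance Definition _ :=
  GRing.isMonoidMorphism.Build B tens tensr tensr_monoid.

Lemma tens_square r : tensl (f r) = tensr (g r).
Proof. by rewrite /tensl -[f r]mulr1 (balancedM pure_balanced) mulr1. Qed.
End Tensor.

Section Swap.
Variables (R A B : comPzRingType).
Variables (f : {rmorphism R -> A}) (g : {rmorphism R -> B}).

Definition tens_swap : tens f g -> tens g f :=
  tens_lift (fun a c => pure g f c a).

Let swap_balanced : balanced f g (fun a c => pure g f c a).
Proof.
have pb := pure_balanced g f.
split=> [x y c|x c d|r x c].
- exact: (balancedDr pb).
- exact: (balancedDl pb).
- by rewrite (balancedM pb).
Qed.

Lemma tens_swapE a c : tens_swap (pure f g a c) = pure g f c a.
Proof. by rewrite /tens_swap; have [_ ->] := tens_univ swap_balanced. Qed.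

Let swap_zmod : zmod_morphism tens_swap.
Proof. by have [] := tens_univ swap_balanced. Qed.

HB.instance Definition _ := GRing.isZmodMorphism.Build (tens f g) (tens g f)
  tens_swap swap_zmod.

Let swap_monoid : monoid_morphism tens_swap.
Proof.
split; first exact: tens_swapE.
elim/tsum_ind=> x; elim/tsum_ind=> y; rewrite !tsumE.
rewrite big_distrlr !raddf_sum big_distrlr; apply: eq_bigr => p _.
rewrite raddf_sum; apply: eq_bigr => q _.
by rewrite /= pureM !tens_swapE pureM.
Qed.

HB.instance Definition _ := GRing.isMonoidMorphism.Build (tens f g) (tens g f)
  tens_swap swap_monoid.

Lemma tens_swap_base r : tens_swap (tensl f g (f r)) = tensl g f (g r).
Proof. by rewrite tens_square tens_swapE. Qed.

Definition hom_swap (M : lmodType R) :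
    homR (tensl g f \o g) M -> homR (tensl f g \o f) M :=
  @hom_pull R _ _ (tensl f g \o f) (tensl g f \o g) tens_swap tens_swap_base M.
End Swap.
Arguments hom_swap {R A B} f g {M} _.

Lemma tens_swapK (R A B : comPzRingType)
    (f : {rmorphism R -> A}) (g : {rmorphism R -> B}) :
  cancel (@tens_swap R A B f g) (@tens_swap R B A g f).
Proof.
elim/tsum_ind=> x; rewrite tsumE (raddf_sum (@tens_swap R A B f g)).
rewrite (raddf_sum (@tens_swap R B A g f)); apply: eq_bigr => p _.
by rewrite /= !tens_swapE.
Qed.

Definition is_prime_ideal (R : comPzRingType) (p : set R) : Prop :=
  [/\ p 0, (forall a b, p a -> p b -> p (a + b)),
      (forall a b, p b -> p (a * b)), ~ p 1 &
      forall a b, p (a * b) -> p a \/ p b].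

Record spec (R : comPzRingType) := Spec {
  spec_set :> set R;
  spec_prime : is_prime_ideal spec_set
}.

Section Zariski.
Variable R : comPzRingType.

HB.instance Definition _ := gen_eqMixin (spec R).
HB.instance Definition _ := gen_choiceMixin (spec R).

Definition distinguished (r : R) : set (spec R) := [set p | ~ spec_set p r].

Definition zariski_open : set_system (spec R) :=
  [set A | forall p, A p ->
     exists r, distinguished r p /\ distinguished r `<=` A].

Let zariski_openT : zariski_open setT.
Proof. by move=> p _; exists 1; split=> //; case: (spec_prime p). Qed.

Let zariski_openI : setI_closed zariski_open.
Proof.
move=> A C hA hC p [/hA[r [pr rA]] /hC[s [ps sC]]]; exists (r * s); split.
  by case: (spec_prime p) => _ _ _ _ pp /pp[].
move=> q qrs; case: (spec_prime q) => _ _ qM _ _; split.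
  by apply: rA => qr; apply: qrs; rewrite mulrC; exact: qM.
by apply: sC => qs; apply: qrs; exact: qM.
Qed.

Let zariski_open_bigU (I : Type) (F : I -> set (spec R)) :
  (forall i, zariski_open (F i)) -> zariski_open (\bigcup_i F i).
Proof.
move=> hF p [i _ /hF[r [pr rF]]]; exists r; split=> // q /rF Fq.
by exists i.
Qed.

HB.instance Definition _ := isOpenTopological.Build (spec R)
  zariski_openT zariski_openI zariski_open_bigU.
End Zariski.

Section SpecMap.
Variables (R S : comPzRingType) (f : {rmorphism R -> S}).

Let preimage_prime (q : spec S) : is_prime_ideal (f @^-1` q).
Proof.
case: (spec_prime q) => q0 qD qM q1 qp; split=> /=.
- by rewrite rmorph0.
- by move=> a b; rewrite rmorphD; exact: qD.
- by move=> a b; rewrite rmorphM; exact: qM.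
- by rewrite rmorph1.
- by move=> a b; rewrite rmorphM; exact: qp.
Qed.

Definition spec_map (q : spec S) : spec R := Spec (preimage_prime q).

(* The first three conditions say that [Spec S -> Spec R] is a homeomorphism
   onto an open subset, the last one that it is an isomorphism of structure
   sheaves over this subset, on the basis of distinguished open sets [D(r)]:
   the sections over [D(r)] are [R[r^-1]], and those over the preimage
   [D(f r)] are [S[f(r)^-1]]. *)
Definition open_immersion : Prop :=
  [/\ continuous spec_map, injective spec_map,
      (forall A : set (spec S), open A -> open (spec_map @` A)) &
      forall r : R, distinguished r `<=` range spec_map ->
        bijective (@loc_map R S f r)].
End SpecMap.

Definition affine_open_covering (R : comPzRingType) (n : nat)
    (S : 'I_n -> comPzRingType) (f : forall l, {rmorphism R -> S l}) : Prop :=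
  (forall l, open_immersion (f l)) /\
  \bigcup_(l in [set: 'I_n]) range (spec_map (f l)) = setT.

(* An ordinal is given as an element [wo_elt] of a well-ordered set; its value
   is the order type of [{b | b < wo_elt}], and the smaller ordinals are given
   by the elements of this initial segment. *)
Record Ord := MkOrd {
  wo_disp : Order.disp_t;
  wo_type : orderType wo_disp;
  wo_wf : well_founded (fun x y : wo_type => (x < y)%O);
  wo_elt : wo_type
}.

Section Diffop.
Variables (K R : comPzRingType) (k : {rmorphism K -> R}) (U V : lmodType R).
Implicit Types (e : U -> V) (r : R).

Definition base_linear e : Prop :=
  forall (c : K) u v, e (k c *: u + v) = k c *: e u + e v.

Definition bracket r e : U -> V := fun u => r *: e u - e (r *: u).

Section Filtration.
Variables (d : Order.disp_t) (W : orderType d).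
Hypothesis W_wf : well_founded (fun x y : W => (x < y)%O).

(* The clauses for [F_0] and for [F_a], [a > 0], are merged, as [0] belongs to
   every [F_b] and the union over [b < 0] is empty: see [diffop_filt0] and
   [diffop_filt_gt0]. *)
Definition diffop_filt : W -> set (U -> V) :=
  Fix W_wf (fun=> set (U -> V))
    (fun a F => [set e | base_linear e /\ forall r,
       (forall u, bracket r e u = 0) \/
       exists (b : W) (ba : (b < a)%O), F b ba (bracket r e)]).

Lemma diffop_filtE a e : diffop_filt a e <->
  base_linear e /\ forall r, (forall u, bracket r e u = 0) \/
    exists2 b, (b < a)%O & diffop_filt b (bracket r e).
Proof.
rewrite {1}/diffop_filt Fix_eq; last first.
  move=> x F G FG; apply/funext => h; apply/propext.
  split=> -[hl H]; split=> // r; case: (H r) => [|[b [bx Hb]]]; try by left.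
    by right; exists b, bx; rewrite -FG.
  by right; exists b, bx; rewrite FG.
split=> -[hl H]; split=> // r; case: (H r); try by left.
  by move=> [b [ba Fb]]; right; exists b.
by move=> [b ba Fb]; right; exists b, ba.
Qed.

Lemma diffop_filt0 a e : (forall b, ~~ (b < a)%O) ->
  diffop_filt a e <->
  base_linear e /\ forall r u, bracket r e u = 0.
Proof.
move=> a0; rewrite diffop_filtE; split=> -[hl H]; split=> // r.
  by case: (H r) => // -[b]; rewrite (negPf (a0 b)).
by left; exact: H.
Qed.

Lemma diffop_filt_gt0 a b0 e : (b0 < a)%O ->
  diffop_filt a e <->
  base_linear e /\ forall r,
    (\bigcup_(b in [set b | (b < a)%O]) diffop_filt b) (bracket r e).
Proof.
move=> b0a; rewrite diffop_filtE; split=> -[hl H]; split=> // r.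
  case: (H r) => [z|[b ba Fb]]; last by exists b.
  exists b0 => //; apply/diffop_filtE; split=> [c u v|s].
    by rewrite !z scaler0 addr0.
  by left=> u; rewrite {1}/bracket !z scaler0 subr0.
by case: (H r) => b ba Fb; right; exists b.
Qed.
End Filtration.

Definition quite_diffop_le (a : Ord) : set (U -> V) :=
  diffop_filt (@wo_wf a) (wo_elt a).

Definition quite_diffop e : Prop := exists a : Ord, quite_diffop_le a e.
End Diffop.

Definition induced (K A A' : comPzRingType) (k : {rmorphism K -> A})
    (phi : {rmorphism A -> A'}) (M N : lmodType A)
    (D : M -> N) (D' : homR phi M -> homR phi N) : Prop :=
  quite_diffop (phi \o k) D' /\ forall g : homR phi M, D' g 1 = D (g 1).

(* For [R -> A -> B]: the operator [E : Hom_R(B, M) -> Hom_R(B, N)] is induced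
   by [D : Hom_R(A, M) -> Hom_R(A, N)], under the identification of
   [Hom_A(B, Hom_R(A, M))] with [Hom_R(B, M)]. *)
Definition induced_tower (K R A B : comPzRingType) (k : {rmorphism K -> R})
    (f : {rmorphism R -> A}) (i : {rmorphism A -> B}) (M N : lmodType R)
    (D : homR f M -> homR f N) (E : homR (i \o f) M -> homR (i \o f) N) : Prop :=
  induced (f \o k) D
    (fun g : homR i (homR f M) => hom_curry (E (hom_uncurry g))).

Arguments induced {K A A'} k phi {M N} D D'.
Arguments induced_tower {K R A B} k f i {M N} D E.

(* Main.v *)
(* A module [U] with [Ext^1_R(R[r^-1], U) = 0] is one in which the recursions
   [b n = c n + r *: b n.+1] are solvable. Therefore subquotients [H] of products
   of colocalizations of [U], such as the homology modules of the Cech complex of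
   a principal covering [D(r_i)], satisfy [Ext^1_R(R[r_i^-1], H) = 0]; and since
   the complex becomes contractible over each [D(r_i)], also
   [Hom_R(R[r_i^-1], H) = 0]. The set of [x] for which [1 - x t] is bijective for
   all endomorphisms [t] of [H] is an ideal containing the [r_i], so it contains
   [1], and [H = 0].

   Hence, choosing for each [l] principal opens [D(r_i)] of [Spec R] which cover
   [Spec S_l], both [U] and [Hom_R(S_l, U)] are generated by the
   [Hom_R(R[r_i^-1], U)], and the relations in [U] come from the double overlaps.
   So [D0 (h 1) := D_l h 1], for [h] in [Hom_R(R[r_i^-1], U)], is a well-defined
   operator. Its order is bounded by transfinite induction, because the brackets
   [[r, D_l]] are compatible with [[r, D0]]. *)

Require Import Defs.
From HB Require Import structures.
From mathcomp Require Import all_boot all_order all_algebra zify.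
From mathcomp Require Import all_classical topology.
Set Implicit Arguments.
Unset Strict Implicit.
Unset Printing Implicit Defensive.
Import Order.TTheory GRing.Theory Defs.
Local Open Scope classical_set_scope.
Local Open Scope ring_scope.

(** * Subquotients and contramodules *)

Record submodule (R : pzRingType) (M : lmodType R) := Submodule {
  submod_set :> M -> Prop;
  submod0 : submod_set 0;
  submodD : forall u v, submod_set u -> submod_set v -> submod_set (u + v);
  submodZ : forall r u, submod_set u -> submod_set (r *: u)
}.

Section LinearClosed.
Variables (R : pzRingType) (M : lmodType R) (A : set M) (A0 : A 0).
Hypothesis AP : forall r u v, A u -> A v -> A (r *: u + v).

Let closedD u v : A u -> A v -> A (u + v).
Proof. by rewrite -{2}[u]scale1r; exact: AP. Qed.

Let closedZ r u : A u -> A (r *: u).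
Proof. by move=> Au; rewrite -[_ *: _]addr0; exact: AP. Qed.

Definition submodule_of := Submodule A0 closedD closedZ.
End LinearClosed.

Section SubmoduleTheory.
Variables (R : pzRingType) (M : lmodType R) (A : submodule M).

Lemma submodN u : A u -> A (- u).
Proof. by move=> Au; rewrite -scaleN1r; exact: submodZ. Qed.

Lemma submodB u v : A u -> A v -> A (u - v).
Proof. by move=> Au Av; exact/submodD/submodN. Qed.
End SubmoduleTheory.

Section Subquotient.
Variables (R : pzRingType) (M : lmodType R) (A B : submodule M).

(* [A / (A :&: B)], realized on chosen representatives of the classes. *)

Definition subquo_repr (m : M) : M := xget 0 [set m' | A m' /\ B (m' - m)].

Definition subquo_pred (m : M) : bool := `[< A m /\ subquo_repr m = m >].

Definition subquo : Type := {m : M | subquo_pred m}.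
HB.instance Definition _ := Choice.on subquo.

Definition subquo_val (x : subquo) : M := sval x.

Lemma subquo_valP x : A (subquo_val x).
Proof. by case: x => m /= /asboolP[]. Qed.

Lemma subquo_reprP m : A m -> A (subquo_repr m) /\ B (subquo_repr m - m).
Proof.
move=> Am; rewrite /subquo_repr; case: xgetP => [x _ []|/(_ m)] //.
by move=> /(_ (conj Am _)); rewrite subrr => /(_ (submod0 B)).
Qed.

(** The admissible representatives of the two classes form the same set, so [xget] makes the same
    choice. *)
Lemma subquo_repr_eq m m' : B (m - m') -> subquo_repr m = subquo_repr m'.
Proof.
move=> Bmm'; congr xget; apply/seteqP; split=> x [Ax Bx]; split=> //.
  by rewrite -(subrK m x) -addrA; exact: submodD.
rewrite -(subrK m' x) -addrA; apply: submodD => //.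
by rewrite -opprB; exact: submodN.
Qed.

Lemma subquo_class_subproof m : A m ->
  subquo_pred (subquo_repr m).
Proof.
move=> /subquo_reprP[Am Bm]; apply/asboolP; split=> //.
exact: subquo_repr_eq.
Qed.

Definition subquo_class m (Am : A m) : subquo :=
  exist (fun m' => is_true (subquo_pred m')) _ (subquo_class_subproof Am).

Lemma subquo_classK m (Am : A m) : B (subquo_val (subquo_class Am) - m).
Proof. by have [] := subquo_reprP Am. Qed.

Lemma subquo_eq x y : B (subquo_val x - subquo_val y) -> x = y.
Proof.
case: x y => [m hm] [m' hm'] /= /subquo_repr_eq e; apply: val_inj => /=.
by move: hm hm' => /asboolP[_ <-] /asboolP[_ <-].
Qed.

Let eqv m m' := B (m - m').
Let eqv_refl m : eqv m m. Proof. by rewrite /eqv subrr; exact: submod0. Qed.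
Let eqv_sym m m' : eqv m m' -> eqv m' m.
Proof. by move=> /submodN; rewrite opprB. Qed.
Let eqv_trans m m' m'' : eqv m m' -> eqv m' m'' -> eqv m m''.
Proof. by move=> h h'; rewrite /eqv -(subrKA m'); exact: submodD. Qed.
Let eqvD m m' n n' : eqv m m' -> eqv n n' -> eqv (m + n) (m' + n').
Proof. by move=> h h'; rewrite /eqv opprD addrACA; exact: submodD. Qed.
Let eqvZ r m m' : eqv m m' -> eqv (r *: m) (r *: m').
Proof. by move=> h; rewrite /eqv -scalerBr; exact: submodZ. Qed.

Definition subquo_zero : subquo := subquo_class (submod0 A).
Definition subquo_add x y : subquo :=
  subquo_class (submodD (subquo_valP x) (subquo_valP y)).
Definition subquo_opp x : subquo := subquo_class (submodN (subquo_valP x)).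
Definition subquo_scale r x : subquo := subquo_class (submodZ r (subquo_valP x)).

Let add_eqv x y : eqv (subquo_val (subquo_add x y)) (subquo_val x + subquo_val y).
Proof. exact: subquo_classK. Qed.
Let opp_eqv x : eqv (subquo_val (subquo_opp x)) (- subquo_val x).
Proof. exact: subquo_classK. Qed.
Let scale_eqv r x : eqv (subquo_val (subquo_scale r x)) (r *: subquo_val x).
Proof. exact: subquo_classK. Qed.
Let zero_eqv : eqv (subquo_val subquo_zero) 0.
Proof. exact: subquo_classK. Qed.

Let subquo_addA : associative subquo_add.
Proof.
move=> x y z; apply: subquo_eq; apply: (eqv_trans (add_eqv _ _)).
apply: (eqv_trans (eqvD (eqv_refl _) (add_eqv _ _))); rewrite addrA.
by apply/eqv_sym/(eqv_trans (add_eqv _ _))/eqvD/eqv_refl/add_eqv.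
Qed.

Let subquo_addC : commutative subquo_add.
Proof.
move=> x y; apply: subquo_eq; apply: (eqv_trans (add_eqv _ _)).
by rewrite addrC; exact/eqv_sym/add_eqv.
Qed.

Let subquo_add0 : left_id subquo_zero subquo_add.
Proof.
move=> x; apply: subquo_eq; apply: (eqv_trans (add_eqv _ _)).
by rewrite -[X in eqv _ X]add0r; apply/eqvD/eqv_refl/zero_eqv.
Qed.

Let subquo_addN : left_inverse subquo_zero subquo_opp subquo_add.
Proof.
move=> x; apply: subquo_eq; apply: (eqv_trans (add_eqv _ _)).
apply/eqv_sym/(eqv_trans zero_eqv)/eqv_sym.
by rewrite -(addNr (subquo_val x)); apply/eqvD/eqv_refl/opp_eqv.
Qed.

HB.instance Definition _ := GRing.isZmodule.Build subquo
  subquo_addA subquo_addC subquo_add0 subquo_addN.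

Let subquo_scaleA a b v :
  subquo_scale a (subquo_scale b v) = subquo_scale (a * b) v.
Proof.
apply: subquo_eq; apply: (eqv_trans (scale_eqv _ _)).
apply: (eqv_trans (eqvZ _ (scale_eqv _ _))); rewrite scalerA.
exact/eqv_sym/scale_eqv.
Qed.

Let subquo_scale1 : left_id 1 subquo_scale.
Proof.
move=> v; apply: subquo_eq; apply: (eqv_trans (scale_eqv _ _)).
by rewrite scale1r; exact: eqv_refl.
Qed.

Let subquo_scaleDr : right_distributive subquo_scale +%R.
Proof.
move=> a u v; apply: subquo_eq; apply: (eqv_trans (scale_eqv _ _)).
apply: (eqv_trans (eqvZ _ (add_eqv _ _))); rewrite scalerDr.
by apply/eqv_sym/(eqv_trans (add_eqv _ _))/eqvD; exact: scale_eqv.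
Qed.

Let subquo_scaleDl v : {morph subquo_scale^~ v : a b / a + b}.
Proof.
move=> a b; apply: subquo_eq; apply: (eqv_trans (scale_eqv _ _)).
rewrite scalerDl.
by apply/eqv_sym/(eqv_trans (add_eqv _ _))/eqvD; exact: scale_eqv.
Qed.

HB.instance Definition _ := GRing.Zmodule_isLmodule.Build R subquo
  subquo_scaleA subquo_scale1 subquo_scaleDr subquo_scaleDl.

Lemma subquo_class_eq m m' (Am : A m) (Am' : A m') :
  subquo_class Am = subquo_class Am' <-> B (m - m').
Proof.
split=> [e|Bmm']; last by apply: val_inj; exact: subquo_repr_eq.
apply: (eqv_trans (eqv_sym (subquo_classK Am))); rewrite e.
exact: subquo_classK.
Qed.

Lemma subquo_valK x : subquo_class (subquo_valP x) = x.
Proof. by apply: subquo_eq; exact: subquo_classK. Qed.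

Lemma subquo_class_linear r m m' (Am : A m) (Am' : A m')
    (Amm' : A (r *: m + m')) :
  subquo_class Amm' = r *: subquo_class Am + subquo_class Am'.
Proof.
apply: subquo_eq; apply/(eqv_trans (subquo_classK _))/eqv_sym.
apply/(eqv_trans (add_eqv _ _))/eqvD/subquo_classK.
by apply/(eqv_trans (scale_eqv _ _))/eqvZ/subquo_classK.
Qed.

Lemma subquo_classD m m' (Am : A m) (Am' : A m') (Amm' : A (m + m')) :
  subquo_class Amm' = subquo_class Am + subquo_class Am'.
Proof.
apply: subquo_eq; apply/(eqv_trans (subquo_classK _))/eqv_sym.
by apply/(eqv_trans (add_eqv _ _))/eqvD; exact: subquo_classK.
Qed.

Lemma subquo_classZ r m (Am : A m) (Arm : A (r *: m)) :
  subquo_class Arm = r *: subquo_class Am.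
Proof.
apply: subquo_eq; apply/(eqv_trans (subquo_classK _))/eqv_sym.
by apply/(eqv_trans (scale_eqv _ _))/eqvZ/subquo_classK.
Qed.

Lemma subquo_class_eq0 m (Am : A m) : subquo_class Am = 0 <-> B m.
Proof. by rewrite subquo_class_eq subr0. Qed.
End Subquotient.

Section ContramoduleNakayama.
Variables (S : comPzRingType) (Q : lmodType S).
Implicit Types (x y : S) (t : {linear Q -> Q}).

(* [Hom_R(R[x^-1], Q) = 0 = Ext^1_R(R[x^-1], Q)], in terms of the telescope
   resolution of [R[x^-1]]. *)
Definition contra_at x : Prop :=
  (forall c : nat -> Q, exists b, forall n, b n = c n + x *: b n.+1) /\
  (forall b : nat -> Q, (forall n, b n = x *: b n.+1) -> b 0%N = 0).

(* [x] behaves like an element of a Jacobson radical: this is what makes the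
   set of such [x] an ideal. *)
Definition topnilpotent x : Prop := forall t,
  (forall c, exists m, m = c + x *: t m) /\ (forall m, m = x *: t m -> m = 0).

Lemma contra_at_uniq x (c b b' : nat -> Q) : contra_at x ->
  (forall n, b n = c n + x *: b n.+1) -> (forall n, b' n = c n + x *: b' n.+1) ->
  b =1 b'.
Proof.
move=> [_ xU] hb hb' n; apply/eqP; rewrite -subr_eq0; apply/eqP.
(* The second clause of [contra_at] only kills the term of index 0, so the difference is reindexed
   to start at [n]. *)
pose d j := b (n + j)%N - b' (n + j)%N.
have := xU d; rewrite /d addn0; apply=> j.
by rewrite hb hb' addnS opprD addrACA subrr add0r scalerBr.
Qed.

(* The solution of [m = c + x t(m)] is the term [b 0] of the formal sum
   [b n = \sum_j x^j t^(n+j)(c)], and [b n.+1 = t (b n)] by uniqueness. *)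
Lemma contra_at_topnilpotent x : contra_at x -> topnilpotent x.
Proof.
move=> xC t; split=> [c|m mE].
  have [b bE] := xC.1 (fun j => iter j t c).
  exists (b 0%N); rewrite {1}bE; congr (_ + _ *: _).
  suff /(_ 0%N) -> : (fun j => b j.+1) =1 t \o b by [].
  apply: (contra_at_uniq (c := fun j => iter j.+1 t c) xC) => j /=.
    by rewrite bE.
  by rewrite {1}bE linearD linearZ.
(* If [m = x t(m)], the iterates [t^j(m)] form an [x]-divisible sequence starting at [m]. *)
have tZ j v : iter j t (x *: v) = x *: iter j t v.
  by elim: j => //= j ->; rewrite linearZ.
by apply: (xC.2 (fun j => iter j t m)) => j; rewrite iterSr -tZ -mE.
Qed.

(** A right inverse of [1 - x t] obtained by choice is linear, because its defect of linearity lies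
    in the kernel of [1 - x t]. *)
Lemma topnilpotent_inverse x t : topnilpotent x ->
  exists u : {linear Q -> Q}, forall c, u c = c + x *: t (u c).
Proof.
move=> /(_ t)[tS tI]; have [u uE] := choice tS.
suff lin : linear u.
  pose mu := GRing.isLinear.Build S Q Q _ u lin.
  pose u' : {linear Q -> Q} := HB.pack_for {linear Q -> Q} u mu.
  by exists u'.
move=> a v w; apply/eqP; rewrite -subr_eq0; apply/eqP/tI.
rewrite {1}uE {1}(uE v) {1}(uE w) (linearB t) (linearD t) (linearZ_LR t).
rewrite (scalerDr a) [X in _ - X]addrACA opprD addrACA subrr add0r.
by rewrite scalerBr scalerDr !scalerA mulrC.
Qed.

(** The scalar [s] is absorbed into the endomorphism, which is why [topnilpotent] quantifies over
    all [t]. *)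
Lemma topnilpotentM s x : topnilpotent x -> topnilpotent (s * x).
Proof.
move=> xN t; have [tS tI] := xN (s \*: t); split=> [c|m mE].
  by have [m mE] := tS c; exists m; rewrite {1}mE /= scalerA mulrC.
by apply: tI; rewrite /= scalerA mulrC.
Qed.

(* [1 - (x + y) t = (1 - y t u) (1 - x t)] for [u] the inverse of [1 - x t]. *)
Lemma topnilpotentD x y :
  topnilpotent x -> topnilpotent y -> topnilpotent (x + y).
Proof.
move=> xN yN t; have [u uE] := topnilpotent_inverse t xN.
have [tS tI] := yN (t \o u); split=> [c|m mE].
  have [m mE] := tS c; exists (u m).
  by rewrite {1}uE {1}mE -addrA [y *: _ + _]addrC -scalerDl.
(* By injectivity of [1 - x t], its right inverse [u] is also a left inverse. *)
have um : u (m - x *: t m) = m.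
  apply/eqP; rewrite -subr_eq0; apply/eqP/(xN t).2.
  rewrite {1}uE (linearB t) scalerBr.
by rewrite addrAC [_ - _ - _]addrAC subrr add0r addrC.
have m0 : m - x *: t m = 0.
  by apply: tI; rewrite /= um {1}mE scalerDl addrAC subrr add0r.
by apply: (xN t).2; apply/eqP; rewrite -subr_eq0 m0.
Qed.

Lemma contramodule_eq0 (I : finType) (s x : I -> S) :
  (forall i, contra_at (x i)) -> \sum_i s i * x i = 1 -> forall q : Q, q = 0.
Proof.
move=> xC e q.
have N1 : topnilpotent 1.
  rewrite -e; apply: big_ind => [t|y z|i _].
  - by split=> [c|m]; [exists c|]; rewrite scale0r ?addr0.
  - exact: topnilpotentD.
  - exact/topnilpotentM/contra_at_topnilpotent.
(* For [t] the identity, every [q] lies in the kernel of [1 - t]. *)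
by apply: (N1 idfun).2; rewrite scale1r.
Qed.
End ContramoduleNakayama.

(* The hypotheses make [Z / N] a contramodule at every [x i]. *)
Lemma submodule_eq_of_telescopes (S : comPzRingType) (Y : lmodType S)
    (Z N : submodule Y) (I : finType) (s x : I -> S) :
  \sum_i s i * x i = 1 -> N `<=` Z ->
  (forall i (c : nat -> Y), (forall n, Z (c n)) ->
     exists b, forall n, Z (b n) /\ b n = c n + x i *: b n.+1) ->
  (forall i (c : nat -> Y), (forall n, N (c n)) ->
     exists b, forall n, N (b n) /\ b n = c n + x i *: b n.+1) ->
  (forall i (b : nat -> Y), (forall n, Z (b n)) ->
     (forall n, b n = x i *: b n.+1) -> N (b 0%N)) ->
  Z `<=` N.
Proof.
move=> e NZ Zsolve Nsolve tel z Zz.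
apply/(subquo_class_eq0 N Zz)/(contramodule_eq0 _ e) => i; split=> [c|b bE].
  have [b bP] := Zsolve i _ (fun n => subquo_valP (c n)).
  have Zb n : Z (b n) := (bP n).1.
  exists (fun n => subquo_class N (Zb n)) => n.
  have ZS := submodZ (x i) (Zb n.+1).
  have ZcS := submodD (subquo_valP (c n)) ZS.
  have -> : c n + x i *: subquo_class N (Zb n.+1) = subquo_class N ZcS.
    rewrite (subquo_classD _ (subquo_valP (c n)) ZS) subquo_valK.
    by rewrite subquo_classZ.
  by apply/subquo_class_eq; rewrite (bP n).2 subrr; exact: submod0.
pose v n := subquo_val (b n); have Zv n : Z (v n) := subquo_valP (b n).
have bE' n : subquo_class N (Zv n) = b n.
  rewrite -(subquo_valK (b n)); apply/subquo_class_eq.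
  by rewrite subrr; exact: submod0.
(* Representatives of a divisible sequence of [Z / N] are divisible only up to errors in [N].
   Solving the recursion for these errors inside [N] gives a correction [d] that makes [v - d] truly
   divisible, so that [tel] applies. *)
have Nc n : N (v n - x i *: v n.+1).
  have ZS := submodZ (x i) (Zv n.+1).
  apply/(subquo_class_eq N (Zv n) ZS); rewrite subquo_classZ.
  by rewrite !bE'.
have [d dP] := Nsolve i _ Nc.
rewrite -(subquo_valK (b 0%N)); apply/subquo_class_eq0.
rewrite -(subrK (d 0%N) (subquo_val _)); apply: submodD (dP 0%N).1.
apply: (tel i (fun n => v n - d n)) => n.
  by apply: submodB => //; exact/NZ/(dP n).1.
rewrite scalerBr {1}(dP n).2 opprD opprB addrA.
by rewrite (addrC (v n)) subrK.
Qed.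

(** * Solving recursions in contraadjusted modules *)

(* [L] is the colimit of the telescope [F -> F -> ...] of multiplications by [r],
   with structure maps [theta n]. The equations [b n = c n + b n.+1 (r _)] have
   the tails of a formal series as a solution in [U^nat] modulo eventually zero
   sequences. The extension of [L] by [U] consists of the pairs [(e, theta n x)]
   with [e] congruent to the tail at [x] up to a constant sequence, and a
   retraction to [U] turns the tails into a solution in [U]. *)
Section Telescope.
Variables (R : comPzRingType) (F L U : lmodType R) (r : R).
Variables (theta : nat -> {linear F -> L}) (c : nat -> {linear F -> U}).
Hypothesis thetaS : forall n x, theta n x = theta n.+1 (r *: x).
Hypothesis theta_surj : forall t, exists n x, t = theta n x.
Hypothesis theta_ker : forall n x, theta n x = 0 -> exists k, r ^+ k *: x = 0.

(** The partial sums of the formal solution [b n x = \sum_(k >= n) c k (r ^+ (k - n) *: x)]. *)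
Definition tel_sum n (x : F) : nat -> U :=
  fun N => \sum_(n <= k < N) c k (r ^+ (k - n) *: x).

Lemma tel_sumS n x N : (n < N)%N ->
  tel_sum n x N = c n x + tel_sum n.+1 (r *: x) N.
Proof.
move=> nN; rewrite /tel_sum big_ltn // subnn scale1r; congr (_ + _).
rewrite !big_nat; apply: eq_bigr => k /andP[nk _].
by rewrite scalerA -exprSr subnSK.
Qed.

Lemma tel_sum_linear n a x y N :
  tel_sum n (a *: x + y) N = a *: tel_sum n x N + tel_sum n y N.
Proof.
rewrite /tel_sum scaler_sumr -big_split; apply: eq_bigr => k _ /=.
by rewrite scalerDr linearD scalerA mulrC -scalerA linearZ.
Qed.

(** The bound [N0] makes this a condition on germs at infinity, hence compatible with the quotient
    by [tel_null]. *)
Definition tel_rep n (e : ((nat -> U) * L)%type) : Prop := exists x u N0,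
  e.2 = theta n x /\ forall N, (N0 <= N)%N -> e.1 N = u + tel_sum n x N.

Lemma tel_repS n e : tel_rep n e -> tel_rep n.+1 e.
Proof.
(* The first summand of the series moves into the constant; it is present only for [N > n], whence
   the bound [n.+1]. *)
move=> [x [u [N0 [e2 e1]]]]; exists (r *: x), (u + c n x), (maxn N0 n.+1).
split=> [|N]; first by rewrite -thetaS.
by rewrite geq_max => /andP[N0N nN]; rewrite e1 // tel_sumS // addrA.
Qed.

Lemma tel_rep_le m n e : (m <= n)%N -> tel_rep m e -> tel_rep n e.
Proof.
move=> /subnK <- em; elim: (n - m)%N => // j IH.
by rewrite addSn; exact: tel_repS.
Qed.

Lemma tel_sum0 n N : tel_sum n 0 N = 0.
Proof. by rewrite /tel_sum big1 // => k _; rewrite scaler0 linear0. Qed.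

Lemma tel_rep0 n : tel_rep n 0.
Proof.
exists 0, 0, 0%N; split=> [|N _]; first by rewrite linear0.
by rewrite tel_sum0 addr0.
Qed.

Lemma tel_rep_linear n a e e' :
  tel_rep n e -> tel_rep n e' -> tel_rep n (a *: e + e').
Proof.
move=> [x [u [N0 [e2 e1]]]] [x' [u' [N0' [e2' e1']]]].
exists (a *: x + x'), (a *: u + u'), (maxn N0 N0'); split=> [|N] /=.
  by rewrite e2 e2' linearP.
rewrite geq_max => /andP[h h']; rewrite tel_sum_linear.
by rewrite -[LHS]/(a *: e.1 N + e'.1 N) e1 // e1' // scalerDr addrACA.
Qed.

Definition tel_total : set ((nat -> U) * L)%type :=
  [set e | exists n, tel_rep n e].

Let tel_total0 : tel_total 0. Proof. by exists 0%N; exact: tel_rep0. Qed.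

Let tel_total_linear a e e' :
  tel_total e -> tel_total e' -> tel_total (a *: e + e').
Proof.
move=> [n en] [n' en']; exists (maxn n n'); apply: tel_rep_linear.
  by apply: tel_rep_le en; rewrite leq_maxl.
by apply: tel_rep_le en'; rewrite leq_maxr.
Qed.

Definition tel_null : set ((nat -> U) * L)%type :=
  [set e | e.2 = 0 /\ exists N0, forall N, (N0 <= N)%N -> e.1 N = 0].

Let tel_null0 : tel_null 0. Proof. by split=> //; exists 0%N. Qed.

Let tel_null_linear a e e' :
  tel_null e -> tel_null e' -> tel_null (a *: e + e').
Proof.
move=> [e2 [N e1]] [e2' [N' e1']]; split.
  by rewrite /= e2 e2' scaler0 addr0.
exists (maxn N N') => n; rewrite geq_max => /andP[h h'].
by rewrite -[LHS]/(a *: e.1 n + e'.1 n) e1 // e1' // scaler0 addr0.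
Qed.

Let A := submodule_of tel_total0 tel_total_linear.
Let B := submodule_of tel_null0 tel_null_linear.

Definition tel_ext : lmodType R := subquo A B.

Let in_rep (u : U) : A ((fun=> u), 0).
Proof.
exists 0%N, 0, u, 0%N; split=> [|N _]; first by rewrite linear0.
by rewrite tel_sum0 addr0.
Qed.

Definition tel_in (u : U) : tel_ext := subquo_class B (in_rep u).
Definition tel_out (e : tel_ext) : L := (subquo_val e).2.

Let tel_in_linear : linear tel_in.
Proof.
move=> a u v; rewrite /tel_in.
rewrite -(subquo_class_linear B _ _ (submodD (submodZ a (in_rep u)) (in_rep v))).
apply/subquo_class_eq; split; first by rewrite /= scaler0 addr0 subrr.
by exists 0%N => N _; rewrite -[LHS]/(a *: u + v - (a *: u + v)) subrr.
Qed.

Let tel_out_class m (Am : A m) : tel_out (subquo_class B Am) = m.2.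
Proof.
by apply/eqP; rewrite -subr_eq0; apply/eqP; have [] := subquo_classK B Am.
Qed.

Let tel_out_linear : linear tel_out.
Proof.
move=> a x y; rewrite -{1}(subquo_valK x) -{1}(subquo_valK y).
rewrite -(subquo_class_linear B _ _
  (submodD (submodZ a (subquo_valP x)) (subquo_valP y))).
exact: tel_out_class.
Qed.

HB.instance Definition _ := GRing.isLinear.Build R U tel_ext _
  tel_in tel_in_linear.
HB.instance Definition _ := GRing.isLinear.Build R tel_ext L _
  tel_out tel_out_linear.

Let tel_in_inj : injective tel_in.
Proof.
move=> u v /subquo_class_eq[_ [N /(_ N (leqnn _))]].
by move=> /eqP; rewrite subr_eq0 => /eqP.
Qed.

Let basic_rep n (x : F) : A (tel_sum n x, theta n x).
Proof. by exists n, x, 0, 0%N; split=> // N _; rewrite add0r. Qed.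

Let tel_out_surj t : exists e, tel_out e = t.
Proof.
have [n [x ->]] := theta_surj t.
by exists (subquo_class B (basic_rep n x)); exact: tel_out_class.
Qed.

Let tel_exact e : tel_out e = 0 <-> exists u, tel_in u = e.
Proof.
split=> [e0|[u <-]]; last exact: tel_out_class.
have [n [x [u [N0 [e2 e1]]]]] := subquo_valP e.
(* Since a power of [r] kills [x], the series stops at [n + k], and [e] is the class of an
   eventually constant sequence. *)
have [k xk] : exists k, r ^+ k *: x = 0.
  by apply: (theta_ker (n := n)); rewrite -e2.
exists (u + tel_sum n x (n + k)); rewrite -[RHS]subquo_valK.
apply/subquo_class_eq; split.
  by rewrite /= sub0r -[X in - X]/(tel_out e) e0 oppr0.
exists (maxn N0 (n + k)) => N; rewrite geq_max => /andP[h h'].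
rewrite -[LHS]/(u + tel_sum n x (n + k) - (subquo_val e).1 N) e1 //.
rewrite opprD addrACA subrr add0r.
rewrite /tel_sum (@big_cat_nat _ _ _ (n + k) n N) ?leq_addr //=.
rewrite opprD addrA subrr sub0r big_nat big1 ?oppr0 // => j /andP[nkj _].
have -> : (j - n = j - (n + k) + k)%N by lia.
by rewrite exprD -scalerA xk scaler0 linear0.
Qed.

Lemma ext_telescope : Ext1_vanishes L U ->
  exists b : nat -> {linear F -> U}, forall n x, b n x = c n x + b n.+1 (r *: x).
Proof.
move=> /(_ (Extension tel_in_inj tel_out_surj tel_exact))[h /= [hin _]].
(* The first component of [h] retracts the extension onto [U]; it is applied to the class of the
   tail at [x]. *)
pose b n x : U := (h (subquo_class B (basic_rep n x))).1.
have b_lin n : linear (b n).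
  move=> a x y; rewrite /b.
  have -> : subquo_class B (basic_rep n (a *: x + y)) =
      a *: subquo_class B (basic_rep n x) + subquo_class B (basic_rep n y).
    rewrite -(subquo_class_linear B _ _
      (submodD (submodZ a (basic_rep n x)) (basic_rep n y))).
    apply/subquo_class_eq; split; first by rewrite /= linearP subrr.
    exists 0%N => N _; rewrite -[LHS]/(tel_sum n (a *: x + y) N -
      (a *: tel_sum n x N + tel_sum n y N)).
    by rewrite tel_sum_linear subrr.
  by rewrite linearP.
pose bL n : {linear F -> U} := HB.pack_for {linear F -> U} (b n)
  (GRing.isLinear.Build R F U _ (b n) (b_lin n)).
exists bL => n x; rewrite /= /b.
have /(congr1 fst)/= <- := hin (c n x).
rewrite -[RHS]/((h _ + h _).1) -linearD /tel_in.
rewrite -(subquo_classD B _ _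
  (submodD (in_rep (c n x)) (basic_rep n.+1 (r *: x)))).
congr (h _).1; apply/subquo_class_eq; split.
  by rewrite /= add0r -thetaS subrr.
exists n.+1 => N nN.
rewrite -[LHS]/(tel_sum n x N - (c n x + tel_sum n.+1 (r *: x) N)).
by rewrite tel_sumS // subrr.
Qed.
End Telescope.

Lemma loc_frac1 (R : comPzRingType) (r a : R) n :
  frac r a n = loc_inj r a * frac r 1 n.
Proof. by rewrite /loc_inj fracM mulr1. Qed.

Lemma loc_frac_inv (R : comPzRingType) (r : R) n :
  loc_inj r (r ^+ n) * frac r 1 n = 1.
Proof. rewrite /loc_inj fracM -[1 in RHS]/(frac r 1 0); apply/fracP; exists 0%N.
by rewrite !add0n expr0 mul1r !mulr1. Qed.

Lemma frac_eq0 (R : comPzRingType) (r a : R) n :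
  frac r a n = 0 -> exists k, r ^+ k * a = 0.
Proof.
by rewrite -[0 in RHS]/(frac r 0 0) => /fracP[k]; rewrite mulr0; exists (k + 0)%N.
Qed.

Lemma loc_map_zmod (R S : comPzRingType) (f : {rmorphism R -> S}) (r : R) :
  zmod_morphism (@loc_map R S f r).
Proof.
elim/loc_ind=> a m; elim/loc_ind=> b n.
have fracN (T : comPzRingType) (t c : T) p : - frac t c p = frac t (- c) p.
  by rewrite -frac_opp.
by rewrite !loc_mapE !fracN !fracD loc_mapE rmorphD !rmorphM !rmorphXn rmorphN.
Qed.

Lemma loc_map_monoid (R S : comPzRingType) (f : {rmorphism R -> S}) (r : R) :
  monoid_morphism (@loc_map R S f r).
Proof.
split; first by rewrite -[1]/(frac r 1 0) loc_mapE rmorph1.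
by elim/loc_ind=> a m; elim/loc_ind=> b n; rewrite fracM !loc_mapE fracM rmorphM.
Qed.

(** The inverse of [loc_map f r] carries the localization [S -> S[f(r)^-1]] to a map [S -> R[r^-1]].
    The clause on its kernel serves to present [R[r^-1]] as a telescope of copies of [S], the last
    one to compare elements of [S] with fractions. *)
Lemma loc_map_bij_lift (R S : comPzRingType) (f : {rmorphism R -> S}) (r : R) :
  bijective (@loc_map R S f r) -> exists g : {rmorphism S -> loc r},
    [/\ forall a, g (f a) = loc_inj r a,
        forall s, g s = 0 -> exists k, f r ^+ k * s = 0 &
        forall s, exists n a, f r ^+ n * s = f a].
Proof.
move=> [h hK Kh]; pose g s := h (loc_inj (f r) s).
have hZ : zmod_morphism h.
  by move=> x y; apply: (can_inj hK); rewrite loc_map_zmod !Kh.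
have hM : monoid_morphism h.
  have [m1 mM] := loc_map_monoid f r.
  split=> [|x y]; apply: (can_inj hK); first by rewrite Kh m1.
  by rewrite mM !Kh.
have gZ : zmod_morphism g by move=> x y; rewrite /g rmorphB hZ.
have gM : monoid_morphism g.
  by split=> [|x y]; rewrite /g ?rmorph1 ?hM.1 // rmorphM hM.2.
pose gm : {rmorphism S -> loc r} := HB.pack_for {rmorphism S -> loc r} g
  (GRing.isZmodMorphism.Build S (loc r) g gZ)
  (GRing.isMonoidMorphism.Build S (loc r) g gM).
exists gm; split=> [a|s|s].
- by apply: (can_inj hK); rewrite Kh loc_mapE.
- move=> gs0; have : loc_inj (f r) s = 0.
    by rewrite -[LHS]Kh -[h _]/(gm s) gs0 -[0]/(frac r 0 0) loc_mapE rmorph0.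
  exact: frac_eq0.
- have := Kh (loc_inj (f r) s); elim/loc_ind: (h _) => a n.
  rewrite loc_mapE => /fracP[k e]; exists (k + n)%N, (r ^+ k * a).
  by rewrite -e addn0 rmorphM rmorphXn.
Qed.

(* Only [S[r^-1] = R[r^-1]] is needed, as the obstruction lies in
   [Ext^1_R(S[r^-1], U)]. *)
Lemma hom_loc_solve (R S : comPzRingType) (f : {rmorphism R -> S}) (r : R)
    (U : lmodType R) (c : nat -> homR f U) :
  contraadjusted U -> bijective (@loc_map R S f r) ->
  exists b : nat -> homR f U, forall n, b n = c n + f r *: b n.+1.
Proof.
move=> Uc /loc_map_bij_lift[g [gf gker gsurj]].
pose F : lmodType R := restr f S^o.
pose L : lmodType R := restr (@loc_inj R r) (loc r)^o.
(* The maps [s |-> g(s) / r^n] present [R[r^-1]] as the colimit of copies of [S] under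
   multiplication by [r]. *)
pose th n (s : F) : L := g s * frac r 1 n.
have th_lin n : linear (th n).
  move=> a x y; rewrite /th -[a *: x]/(f a * x).
  rewrite -[a *: (_ : L)]/(loc_inj r a * _).
  by rewrite rmorphD rmorphM gf mulrDl mulrA.
pose theta n : {linear F -> L} := HB.pack_for {linear F -> L} (th n)
  (GRing.isLinear.Build R F L _ (th n) (th_lin n)).
have c_lin n : linear (c n : F -> U).
  by move=> a x y; rewrite homD -[a *: x]/(f a * x) homZ.
pose cL n : {linear F -> U} := HB.pack_for {linear F -> U} (c n : F -> U)
  (GRing.isLinear.Build R F U _ (c n : F -> U) (c_lin n)).
have [] := @ext_telescope R F L U r theta cL _ _ _ (Uc r).
- move=> n s; rewrite /= /th -[r *: s]/(f r * s) rmorphM gf.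
  rewrite [X in _ = X * _]mulrC -mulrA /loc_inj fracM mulr1 (frac_expand _ 1).
  by rewrite mulr1 add1n expr1.
- elim/loc_ind=> a n; exists n, (f a).
  by rewrite /= /th gf -loc_frac1.
- move=> n s /= e; have [|k ke] := gker s.
    by rewrite -[LHS]mulr1 -(loc_frac_inv r n) mulrCA -[g s * _]/(th n s) e mulr0.
  by exists k; rewrite -[LHS]/(f (r ^+ k) * s) rmorphXn.
move=> b bE; have bh n : is_hom f (b n : S -> U).
  split=> [x y|a x]; first exact: linearD.
  exact: (linearZ_LR (b n)).
exists (fun n => mk_hom (bh n)) => n; apply: homP => s.
exact: bE.
Qed.

(** The case [S = R] of [hom_loc_solve], through [Hom_R(R, U) = U]. *)
Lemma contraadjusted_solve (R : comPzRingType) (U : lmodType R) (r : R)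
    (c : nat -> U) : contraadjusted U ->
  exists b : nat -> U, forall n, b n = c n + r *: b n.+1.
Proof.
move=> Uc; have ch n : is_hom idfun (fun a : R => a *: c n).
  by split=> [x y|a x]; rewrite ?scalerDl ?scalerA.
have idb : bijective (@loc_map R R idfun r).
  by exists id => x; elim/loc_ind: x => a n; rewrite loc_mapE.
have [b bE] := hom_loc_solve (fun n => mk_hom (ch n)) Uc idb.
exists (fun n => b n 1) => n; rewrite {1}bE hom_addE hom_scaleE /= scale1r.
by rewrite (homZ (b n.+1)).
Qed.

(** * Divisible sequences and the Cech complex of a principal covering *)

Section DivisibleSequences.
Variables (R : comPzRingType) (U : lmodType R).

(* These sequences form [Hom_R(R[r^-1], U)], with [u n] the image of [r^-n]. *)
Definition divseq (r : R) (u : nat -> U) : Prop := forall n, u n = r *: u n.+1.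

Lemma divseq_exp r u n k : divseq r u -> u n = r ^+ k *: u (n + k)%N.
Proof.
move=> ur; elim: k => [|k IH]; first by rewrite addn0 scale1r.
by rewrite IH ur scalerA -exprSr addnS.
Qed.

Lemma divseq_shift r u n : divseq r u -> divseq r (fun m => u (n + m)%N).
Proof. by move=> ur m; rewrite addnS. Qed.

Lemma divseq_linear r a u v : divseq r u -> divseq r v -> divseq r (a *: u + v).
Proof.
move=> ur vr n; rewrite -[LHS]/(a *: u n + v n) ur vr.
by rewrite -[X in _ = _ *: X]/(a *: u n.+1 + v n.+1) scalerDr !scalerA mulrC.
Qed.

Lemma divseqB r u v : divseq r u -> divseq r v -> divseq r (fun n => u n - v n).
Proof. by move=> ur vr n; rewrite scalerBr -ur -vr. Qed.

Lemma divseq0 r : divseq r (fun=> 0). Proof. by move=> n; rewrite scaler0. Qed.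

Definition solvable r : Prop :=
  forall c : nat -> U, exists b, forall n, b n = c n + r *: b n.+1.

(* A recursion for [r] in [Hom_R(R[s^-1], U)] follows from one for [r * s] in [U]
   along the diagonal. *)
Lemma divseq_solve r s (c : nat -> nat -> U) :
  solvable (r * s) -> (forall n, divseq s (c n)) ->
  exists b, (forall n, divseq s (b n)) /\
            (forall n m, b n m = c n m + r *: b n.+1 m).
Proof.
move=> rsU cs; have [d dE] := rsU (fun n => c n n).
(* The diagonal [d n = b n n] determines the rest: the recursion is unrolled [m] times, and
   divisibility by [s] turns [b (n + m) m] into [s ^+ n *: d (n + m)]. *)
pose b n m := \sum_(0 <= i < m) r ^+ i *: c (n + i)%N m +
              (r ^+ m * s ^+ n) *: d (n + m)%N.
have dE' n m : s ^+ n *: d (n + m)%N =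
    c (n + m)%N m + (r * s ^+ n.+1) *: d (n + m).+1.
  rewrite dE scalerDr scalerA; congr (_ + _ *: _); last first.
    by rewrite exprSr mulrCA mulrA mulrAC.
  by rewrite (divseq_exp m n (cs _)) (addnC m).
have bE n m : b n m = \sum_(0 <= i < m.+1) r ^+ i *: c (n + i)%N m +
    (r ^+ m.+1 * s ^+ n.+1) *: d (n + m).+1.
  rewrite /b -scalerA dE' scalerDr scalerA mulrA -exprSr addrA.
  by rewrite big_nat_recr.
exists b; split=> [n m|n m].
  rewrite bE /b scalerDr scaler_sumr scalerA addnS mulrCA -exprS.
  congr (_ + _); apply: eq_bigr => i _.
  by rewrite scalerA mulrC -scalerA -cs.
rewrite bE big_nat_recl // expr0 scale1r addn0 -addrA; congr (_ + _).
rewrite /b scalerDr scaler_sumr scalerA mulrA -exprS addSn; congr (_ + _).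
by apply: eq_bigr => i _; rewrite scalerA -exprS addSnnS.
Qed.
End DivisibleSequences.

Section Cech.
Variables (R : comPzRingType) (U : lmodType R) (I : finType) (r s : I -> R).
Hypothesis U_solvable : forall x, solvable U x.
Hypothesis unit_ideal : \sum_i s i * r i = 1.

Let solve_family (J : Type) (t : J -> R) x (c : nat -> J -> nat -> U) :
  (forall n j, divseq (t j) (c n j)) ->
  exists b : nat -> J -> nat -> U, (forall n j, divseq (t j) (b n j)) /\
    forall n j m, b n j m = c n j m + x *: b n.+1 j m.
Proof.
move=> ct.
have [b bP] := choice (fun j =>
  divseq_solve (U_solvable (x * t j)) (fun n => ct n j)).
exists (fun n j => b j n); split=> [n j|n j m]; first exact: (bP j).1.
exact: (bP j).2.
Qed.

(** An [r i]-divisible sequence in [U] is itself an element of the [i]-th colocalization, so its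
    initial term lies in the image. This is the telescope condition on the cokernel. *)
Lemma divseq_cover_surj (u : U) : exists w : I -> nat -> U,
  (forall i, divseq (r i) (w i)) /\ u = \sum_i w i 0%N.
Proof.
pose Zs : set U := setT.
pose Ns : set U := [set u | exists w : I -> nat -> U,
  (forall i, divseq (r i) (w i)) /\ u = \sum_i w i 0%N].
have Nlin a v v' : Ns v -> Ns v' -> Ns (a *: v + v').
  move=> [w [wr ->]] [w' [wr' ->]]; exists (a *: w + w'); split=> [i|].
    exact: divseq_linear.
  by rewrite scaler_sumr -big_split.
have N0 : Ns 0.
  exists (fun _ _ => 0); split=> [i|]; first exact: divseq0.
  by rewrite big1.
pose Z := @submodule_of R U Zs Logic.I (fun _ _ _ _ _ => Logic.I).
pose N := submodule_of N0 Nlin.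
apply: (@submodule_eq_of_telescopes R U Z N I s r unit_ideal) => //.
- by move=> i c _; have [b bE] := U_solvable (r i) c; exists b.
- move=> i c /choice[w wP].
  have [b [br bE]] := solve_family (r i) (fun n => (wP n).1).
  exists (fun n => \sum_j b n j 0%N) => n; split; first by exists (b n).
  rewrite (wP n).2 scaler_sumr -big_split; apply: eq_bigr => j _.
  exact: bE.
- move=> i b _ br; exists (fun j => if j == i then b else fun=> 0); split=> [j|].
    by case: eqP => [->|_] //; exact: divseq0.
  by rewrite (bigD1 i) //= eqxx big1 ?addr0 // => j /negPf ->.
Qed.

(* Exactness at the middle term of the Cech complex
   [\prod_(i, j) Hom_R(R[(r_i r_j)^-1], U)
     -> \prod_i Hom_R(R[r_i^-1], U) -> U]. *)
Lemma divseq_cover_exact (u : I -> nat -> U) :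
  (forall i, divseq (r i) (u i)) -> \sum_i u i 0%N = 0 ->
  exists w : I -> I -> nat -> U, (forall i j, divseq (r i * r j) (w i j)) /\
    forall i n, u i n = \sum_j r j ^+ n *: w i j n - \sum_j r j ^+ n *: w j i n.
Proof.
pose Zs : set (I -> nat -> U) :=
  [set u | (forall i, divseq (r i) (u i)) /\ \sum_i u i 0%N = 0].
(* As [w i j n] is the image of [(r_i r_j)^-n], the factor [r j ^+ n] makes it the image of
   [r_i^-n]: this is restriction along [R[r_i^-1] -> R[(r_i r_j)^-1]]. *)
pose Ns : set (I -> nat -> U) := [set u | exists w : I -> I -> nat -> U,
  (forall i j, divseq (r i * r j) (w i j)) /\
  forall i n, u i n = \sum_j r j ^+ n *: w i j n - \sum_j r j ^+ n *: w j i n].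
have Zlin a v v' : Zs v -> Zs v' -> Zs (a *: v + v').
  move=> [vr v0] [vr' v0']; split=> [i|]; first exact: divseq_linear.
  rewrite -[LHS]/(\sum_i (a *: v i 0%N + v' i 0%N)) big_split /= -scaler_sumr.
  by rewrite v0 v0' scaler0 addr0.
have Z0 : Zs 0 by split=> [i|]; [exact: divseq0|rewrite big1].
have Nlin a v v' : Ns v -> Ns v' -> Ns (a *: v + v').
  move=> [w [wr e]] [w' [wr' e']]; exists (a *: w + w'); split=> [i j|i n].
    exact: divseq_linear.
  rewrite -[LHS]/(a *: v i n + v' i n) e e' scalerBr addrACA -opprD.
  rewrite !scaler_sumr -!big_split; congr (_ - _); apply: eq_bigr => j _ /=.
    by rewrite scalerA mulrC -scalerA -scalerDr.
  by rewrite scalerA mulrC -scalerA -scalerDr.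
have N0 : Ns 0.
  exists (fun _ _ _ => 0); split=> [i j|i n]; first exact: divseq0.
  by rewrite !big1 ?subr0 // => j _; rewrite scaler0.
pose Z := submodule_of Z0 Zlin.
pose N := submodule_of N0 Nlin.
move=> ur u0; have Zu : Z u by split.
apply: (@submodule_eq_of_telescopes R _ Z N I s r unit_ideal _ _ _ _ u Zu).
- move=> v [w [wr e]]; split=> [i n|].
    rewrite !e scalerBr !scaler_sumr; congr (_ - _); apply: eq_bigr => j _.
      by rewrite wr !scalerA exprSr mulrCA.
    by rewrite wr !scalerA exprSr mulrA mulrC.
  under eq_bigr do rewrite e.
  rewrite sumrB exchange_big /=; apply/eqP; rewrite subr_eq0; apply/eqP.
  by [].
  (* Correct a solution in each factor by a family supported at [k]. *)
- move=> k c cZ; have [b [br bE]] := solve_family (r k) (fun n => (cZ n).1).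
  pose v n := \sum_i b n i 0%N.
  have vr : divseq (r k) v.
    move=> n; rewrite /v; under eq_bigr do rewrite bE.
    by rewrite big_split /= (cZ n).2 add0r scaler_sumr.
  exists (fun n i =>
    if i == k then fun m => b n i m - v (n + m)%N else b n i) => n.
  split; first split=> [i|].
  + case: eqP => [->|_] //; apply: divseqB => //; exact: divseq_shift.
  + rewrite (bigD1 k) //= eqxx addn0 addrAC.
    apply/eqP; rewrite subr_eq0; apply/eqP.
    rewrite /v [RHS](bigD1 k) //=; congr (_ + _).
    by apply: eq_bigr => i /negPf ->.
  + apply/funext => i; apply/funext => m.
    rewrite -[RHS]/(c n i m + r k *:
      (if i == k then fun m => b n.+1 i m - v (n.+1 + m)%N else b n.+1 i) m).
    case: eqP => _; last exact: bE.
    by rewrite bE vr -addrA -scalerBr.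
(* A recursion among boundaries is lifted to the families [w], indexed by pairs, and solved
   there. *)
- move=> k c /choice[w wP].
  have [b [br bE]] := solve_family (t := fun ij => r ij.1 * r ij.2) (r k)
    (c := fun n ij => w n ij.1 ij.2) (fun n ij => (wP n).1 ij.1 ij.2).
  exists (fun n i m =>
    \sum_j r j ^+ m *: b n (i, j) m - \sum_j r j ^+ m *: b n (j, i) m).
  move=> n; split.
    by exists (fun i j => b n (i, j)); split=> // i j; exact: br n (i, j).
  apply/funext => i; apply/funext => m.
  rewrite -[RHS]/(c n i m + r k *:
    (\sum_j r j ^+ m *: b n.+1 (i, j) m - \sum_j r j ^+ m *: b n.+1 (j, i) m)).
  rewrite (wP n).2 scalerBr addrACA -opprD !scaler_sumr -!big_split.
  congr (_ - _); apply: eq_bigr => j _;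
    by rewrite /= bE scalerDr !scalerA [r k * _]mulrC.
  (* The contracting homotopy of the Cech complex restricted to [D(r k)]. *)
- move=> k b bZ bk.
  have bkE n i m : b n i m = r k *: b n.+1 i m by rewrite {1}bk.
  have bkX n i m : b 0%N i m = r k ^+ n *: b n i m.
    by apply: (divseq_exp (u := fun n => b n i m) 0 n) => p; exact: bkE.
  exists (fun i j n => if j == k then b n i n else 0); split=> [i j n|i n].
    case: eqP => [->|_]; last by rewrite scaler0.
    by rewrite ((bZ n).1 i n) bkE scalerA.
  rewrite (bigD1 k) //= eqxx -bkX big1 ?addr0; last first.
    by move=> j /negPf ->; rewrite scaler0.
  case: eqP => [->|_]; last by rewrite big1 ?subr0 // => j _; rewrite scaler0.
  rewrite [X in _ - X](_ : _ = 0) ?subr0 //.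
  rewrite -[RHS](bZ n).2; apply: eq_bigr => j _.
  by rewrite (divseq_exp 0 n ((bZ n).1 j)).
Qed.
End Cech.

(** * Homomorphisms from localizations and the generation of [Hom_R(S, U)] *)

Lemma loc_hom_of_divseq (R : comPzRingType) (U : lmodType R) (r : R)
    (u : nat -> U) :
  divseq r u -> exists h : homR (@loc_inj R r) U, forall n, h (frac r 1 n) = u n.
Proof.
move=> ur; pose h (x : loc r) := (repr x).1 *: u (repr x).2.
have hE a n : h (frac r a n) = a *: u n.
  rewrite /h; have := frac_repr (frac r a n).
  case: (repr (frac r a n)) => [a' n'] /= /fracP[k e].
  rewrite (divseq_exp n' (k + n) ur) (divseq_exp n (k + n') ur).
  by rewrite !scalerA [a' * _]mulrC [a * _]mulrC e; congr (_ *: u _); lia.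
have hh : is_hom (@loc_inj R r) h.
  split=> [|a]; last first.
    by elim/loc_ind=> b n; rewrite /loc_inj fracM !hE scalerA.
  elim/loc_ind=> a m; elim/loc_ind=> b n; rewrite fracD !hE scalerDl.
  rewrite (divseq_exp m n ur) (divseq_exp n m ur) !scalerA (addnC n).
  by rewrite ![_ * r ^+ _]mulrC.
by exists (mk_hom hh) => n; rewrite /= hE scale1r.
Qed.

Lemma divseq_of_loc_hom (R : comPzRingType) (U : lmodType R) (r : R)
  (h : homR (@loc_inj R r) U) : divseq r (fun n => h (frac r 1 n)).
Proof.
move=> n; rewrite -homZ /loc_inj fracM; congr (hom_fun h _).
by rewrite (frac_expand r 1) expr1.
Qed.

Lemma loc_hom_frac (R : comPzRingType) (U : lmodType R) (r a : R) n
  (h : homR (@loc_inj R r) U) : h (frac r a n) = a *: h (frac r 1 n).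
Proof. by rewrite loc_frac1 homZ. Qed.

Lemma loc_hom_eq (R : comPzRingType) (U : lmodType R) (r : R)
    (h h' : homR (@loc_inj R r) U) :
  (forall n, h (frac r 1 n) = h' (frac r 1 n)) -> h = h'.
Proof.
by move=> e; apply: homP; elim/loc_ind=> a n;
  rewrite loc_hom_frac e -loc_hom_frac.
Qed.

Lemma hom_sumE (R S : comPzRingType) (f : {rmorphism R -> S}) (U : lmodType R)
    (I : finType) (h : I -> homR f U) t :
  (\sum_i h i) t = \sum_i h i t.
Proof. by apply: (big_morph (fun h : homR f U => h t)). Qed.

(** The type of [y j] varies with [j], so [x] is transported along a proof of [i = j]; such proofs
    are unique because [I] has decidable equality. *)
Lemma dep_delta (I : eqType) (T : I -> zmodType) i (x : T i) :
  exists y : forall j, T j, y i = x /\ forall j, j != i -> y j = 0.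
Proof.
exists (fun j => match i =P j with
                 | ReflectT e => let: erefl := e in x | ReflectF _ => 0 end).
split=> [|j ji]; case: eqP => // e; first by rewrite (eq_irrelevance e erefl).
by rewrite e eqxx in ji.
Qed.

Section HomCover.
Variables (R S : comPzRingType) (f : {rmorphism R -> S}) (U : lmodType R).
Variables (I : finType) (r : I -> R) (s : I -> S).
Variable g : forall i, {rmorphism S -> loc (r i)}.
Hypothesis gf : forall i a, g i (f a) = loc_inj (r i) a.
Hypothesis g_num : forall i t, exists n a, f (r i) ^+ n * t = f a.
Hypothesis loc_map_bij : forall i, bijective (@loc_map R S f (r i)).
Hypothesis unit_ideal : \sum_i s i * f (r i) = 1.
Hypothesis U_contra : contraadjusted U.

(** The argument of [divseq_cover_surj] is repeated over the ring [S], with [hom_loc_solve]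
    providing the solutions in [Hom_R(S, U)]. *)
Lemma hom_cover_surj (phi : homR f U) :
  exists h : forall i, homR (@loc_inj R (r i)) U,
    phi = \sum_i hom_pull (gf i) (h i).
Proof.
pose Ns : set (homR f U) := [set phi |
  exists h : forall i, homR (@loc_inj R (r i)) U,
    phi = \sum_i hom_pull (gf i) (h i)].
have N0 : Ns 0.
  by exists (fun=> 0); rewrite big1 // => i _; apply: homP.
have Nlin a v v' : Ns v -> Ns v' -> Ns (a *: v + v').
  move=> [h ->] [h' ->]; exists (fun i => g i a *: h i + h' i).
  rewrite scaler_sumr -big_split; apply: eq_bigr => i _; apply: homP => t.
  by rewrite /= rmorphM.
pose Z := @submodule_of S (homR f U) setT Logic.I (fun _ _ _ _ _ => Logic.I).
pose N := submodule_of N0 Nlin.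
apply: (@submodule_eq_of_telescopes S _ Z N I s (f \o r) unit_ideal) => //.
- move=> i c _; have [b bE] := hom_loc_solve c U_contra (loc_map_bij i).
  by exists b.
- move=> k c /choice[h hE].
  have solve i : exists b : nat -> homR (@loc_inj R (r i)) U,
      forall n, b n = h n i + loc_inj (r i) (r k) *: b n.+1.
    have [|b [br bE]] := @divseq_solve R U (r k) (r i)
      (fun n m => h n i (frac (r i) 1 m)) _ (fun n => divseq_of_loc_hom (h n i)).
      by move=> c'; exact: contraadjusted_solve.
    have [b' bb'] := choice (fun n => loc_hom_of_divseq (br n)).
    exists b' => n; apply: loc_hom_eq => m.
    by rewrite hom_addE hom_scaleE homZ !bb' bE.
  pose b i := projT1 (cid (solve i)); pose bE i := projT2 (cid (solve i)).
  exists (fun n => \sum_i hom_pull (gf i) (b i n)) => n; split.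
    by exists (b^~ n).
  rewrite hE scaler_sumr -big_split; apply: eq_bigr => i _; apply: homP => t.
  by rewrite hom_addE hom_scaleE /= [b i n]bE hom_addE hom_scaleE rmorphM gf.
- move=> k b _ bk; have b1 : divseq (r k) (fun n => b n 1).
    by move=> n; rewrite bk hom_scaleE /= homZ.
  have [h hE] := loc_hom_of_divseq b1.
  have [h' [h'k h'0]] := @dep_delta I (fun i => homR (@loc_inj R (r i)) U) k h.
  exists h'; rewrite (bigD1 k) //= big1 ?addr0 => [|i ik]; last first.
    by rewrite h'0 //; exact: homP.
  rewrite h'k.
  (* A divisible sequence [b] is recovered from the values [b n 1]: when [f(r_k)^n t = f(a)], one
     has [b 0 t = b n (f a) = a *: b n 1], which is the value of [h] at [a / r_k^n]. *)
  apply: homP => t; have [n [a e]] := g_num k t.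
  have bX : b 0%N = f (r k) ^+ n *: b n.
    elim: n {e} => [|n IH]; first by rewrite scale1r.
    by rewrite IH bk scalerA -exprSr.
  have gt : g k t = frac (r k) a n.
    rewrite loc_frac1 -gf -e rmorphM rmorphXn gf mulrAC -rmorphXn.
    by rewrite loc_frac_inv mul1r.
  by rewrite bX hom_scaleE e /= gt loc_hom_frac hE -[f a]mulr1 homZ.
Qed.
End HomCover.

(** * Finite principal refinements *)

Lemma loc_lift (R C : comPzRingType) (f : {rmorphism R -> C}) (r : R) (y : C) :
  f r * y = 1 ->
  exists g : {rmorphism loc r -> C}, forall a n, g (frac r a n) = f a * y ^+ n.
Proof.
move=> ry; have ryX n : f r ^+ n * y ^+ n = 1 by rewrite -exprMn ry expr1n.
pose g (x : loc r) := f (repr x).1 * y ^+ (repr x).2.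
have gE a n : g (frac r a n) = f a * y ^+ n.
  rewrite /g; have := frac_repr (frac r a n).
  case: (repr (frac r a n)) => [a' n'] /= /fracP[k /(congr1 f)].
  rewrite !rmorphM !rmorphXn => e.
  rewrite -[LHS]mulr1 -(ryX (k + n)%N) -[RHS]mulr1 -(ryX (k + n')%N).
  rewrite [LHS]mulrACA [f a' * _]mulrC e [RHS]mulrACA [f a * _]mulrC.
  rewrite -!mulrA -!exprD.
  by congr (_ * (_ * y ^+ _)); lia.
have gZ : zmod_morphism g.
  elim/loc_ind=> a m; elim/loc_ind=> b n.
  have -> : - frac r b n = frac r (- b) n by rewrite -frac_opp.
  rewrite fracD !gE rmorphD !rmorphM rmorphN !rmorphXn mulrDl exprD.
  congr (_ + _).
    by rewrite -mulrA mulrCA [_ * (y ^+ m * _)]mulrCA ryX mulr1.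
  by rewrite mulrACA ryX mul1r mulNr.
have gM : monoid_morphism g.
  split; first by rewrite -[1]/(frac r 1 0) gE rmorph1 mulr1.
  elim/loc_ind=> a m; elim/loc_ind=> b n.
  by rewrite fracM !gE rmorphM exprD mulrACA.
by exists (HB.pack_for {rmorphism loc r -> C} g
  (GRing.isZmodMorphism.Build (loc r) C g gZ)
  (GRing.isMonoidMorphism.Build (loc r) C g gM)).
Qed.

Lemma tens_lift_rmorphism (R A B C : comPzRingType)
    (f : {rmorphism R -> A}) (g : {rmorphism R -> B}) (q : {rmorphism R -> C})
    (a : {rmorphism A -> C}) (b : {rmorphism B -> C}) :
  (forall x, a (f x) = q x) -> (forall x, b (g x) = q x) ->
  exists m : {rmorphism tens f g -> C},
    forall x y, m (pure f g x y) = a x * b y.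
Proof.
move=> aP bP; have bal : balanced f g (fun x y => a x * b y).
  split=> [x y c|x c d|r x c]; rewrite ?rmorphD ?mulrDl ?mulrDr //.
  by rewrite !rmorphM aP bP mulrCA !mulrA.
have [mZ mE] := tens_univ bal.
pose m0 : {additive tens f g -> C} := HB.pack_for {additive tens f g -> C}
  (tens_lift (fun x y => a x * b y))
  (GRing.isZmodMorphism.Build (tens f g) C _ mZ).
have mM : monoid_morphism m0.
  split; first by rewrite -[1]/(pure f g 1 1) /= mE !rmorph1 mulr1.
  elim/tsum_ind=> x; elim/tsum_ind=> y; rewrite !tsumE.
  rewrite big_distrlr !raddf_sum big_distrlr; apply: eq_bigr => p _.
  rewrite raddf_sum; apply: eq_bigr => p' _.
  by rewrite /= pureM !mE !rmorphM mulrACA.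
by exists (HB.pack_for {rmorphism tens f g -> C} (m0 : tens f g -> C)
  (GRing.isZmodMorphism.Build (tens f g) C _ mZ)
  (GRing.isMonoidMorphism.Build (tens f g) C _ mM)).
Qed.

(** Otherwise Zorn's lemma would extend [J] to a maximal proper ideal, which is prime. *)
Lemma maximal_ideal_prime (S : comPzRingType) (J : set S) :
  J 0 -> (forall a b, J a -> J b -> J (a + b)) ->
  (forall a b, J b -> J (a * b)) ->
  (forall p : spec S, exists2 x, J x & ~ spec_set p x) -> J 1.
Proof.
move=> J0 JD JM Jp; apply: contrapT => J1.
pose proper_ideal (X : set S) := [/\ X 0, (forall a b, X a -> X b -> X (a + b)),
  (forall a b, X b -> X (a * b)), ~ X 1 & J `<=` X].
(* [set0] is included because [Zorn_bigcup] considers the empty chain. *)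
pose P (X : set S) := X = set0 \/ proper_ideal X.
have Pne X x : P X -> X x -> proper_ideal X by case=> // ->.
have [|A [PA Amax]] := @Zorn_bigcup S P.
  move=> F FP Ftot; case: (pselect (exists2 X, F X & exists x, X x)); last first.
    move=> noF; left; rewrite -subset0 => x [X FX Xx]; apply: noF.
    by exists X => //; exists x.
  move=> [X0 FX0 [x0 X0x0]]; right.
  have [X00 _ _ _ JX0] := Pne _ _ (FP _ FX0) X0x0.
  split.
  - by exists X0.
  - move=> a b [X FX Xa] [Y FY Yb].
    have [XY|YX] := Ftot _ _ FX FY.
      have [_ YD _ _ _] := Pne _ _ (FP _ FY) Yb.
      by exists Y => //; apply: YD => //; exact: XY.
    have [_ XD _ _ _] := Pne _ _ (FP _ FX) Xa.
    by exists X => //; apply: XD => //; exact: YX.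
  - move=> a b [X FX Xb]; have [_ _ XM _ _] := Pne _ _ (FP _ FX) Xb.
    by exists X => //; exact: XM.
  - by move=> [X FX X1]; have [_ _ _ /(_ X1)] := Pne _ _ (FP _ FX) X1.
  - by move=> x /JX0 X0x; exists X0.
case: PA => [A0|[A0 AD AM A1 JA]].
  apply: (Amax J); last by right; split.
  by rewrite A0; split=> [x []|/(_ 0 J0)].
have prime : is_prime_ideal A.
  split=> // a b Aab; case: (pselect (A a)) => [|Aa]; [by left|right].
  apply: contrapT => Ab.
  (* The ideal [A + (a)] is strictly larger than [A]. It is proper, as [1 = y + c a] would give
     [b = y b + c a b] in [A]. *)
  pose A' : set S := [set x | exists2 y, A y & exists c, x = y + c * a].
  apply: (Amax A').
    split=> [x Ax|/(_ a)]; first by exists x => //; exists 0; rewrite mul0r addr0.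
    by apply: contra_not Aa; apply; exists 0 => //; exists 1; rewrite mul1r add0r.
  right; split.
  - by exists 0 => //; exists 0; rewrite mul0r addr0.
  - move=> _ _ [y Ay [c ->]] [y' Ay' [c' ->]]; exists (y + y'); first exact: AD.
    by exists (c + c'); rewrite mulrDl addrACA.
  - move=> d _ [y Ay [c ->]]; exists (d * y); first exact: AM.
    by exists (d * c); rewrite mulrDr mulrA.
  - move=> [y Ay [c e]]; apply: Ab; rewrite -[b]mul1r e mulrDl mulrC.
    by apply: AD; [exact: AM|rewrite -mulrA; exact: AM].
  - by move=> x Jx; exists x; [exact: JA|exists 0; rewrite mul0r addr0].
by have [x /JA Ax] := Jp (Spec prime).
Qed.

Lemma fin_unit_ideal (S : comPzRingType) (I : finType) (x : I -> S) :
  (forall p : spec S, exists i, ~ spec_set p (x i)) ->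
  exists s, \sum_i s i * x i = 1.
Proof.
move=> xp; pose J : set S := [set y | exists s, \sum_i s i * x i = y].
apply: (@maximal_ideal_prime S J).
- by exists (fun=> 0); rewrite big1 // => i _; rewrite mul0r.
- move=> _ _ [s <-] [t <-]; exists (fun i => s i + t i); rewrite -big_split.
  by apply: eq_bigr => i _; rewrite mulrDl.
- move=> a _ [s <-]; exists (fun i => a * s i); rewrite mulr_sumr.
  by apply: eq_bigr => i _; rewrite mulrA.
- move=> p; have [i xi] := xp p; exists (x i) => //.
  exists (fun j => if j == i then 1 else 0); rewrite (bigD1 i) //= eqxx mul1r.
  by rewrite big1 ?addr0 // => j /negPf ->; rewrite mul0r.
Qed.

(** This is quasi-compactness of [Spec S]: writing [1] in the ideal generated by [X] takes finitely
    many elements. *)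
Lemma set_unit_ideal (S : comPzRingType) (X : set S) :
  (forall p : spec S, exists2 x, X x & ~ spec_set p x) ->
  exists m (x s : 'I_m -> S), (forall i, X (x i)) /\ \sum_i s i * x i = 1.
Proof.
move=> Xp; pose J : set S := [set y | exists l : seq (S * S),
  (forall p, p \in l -> X p.2) /\ \sum_(p <- l) p.1 * p.2 = y].
have [l [lX l1]] : J 1.
  apply: (@maximal_ideal_prime S J).
  - by exists [::]; rewrite big_nil.
  - move=> _ _ [l [lX <-]] [l' [lX' <-]]; exists (l ++ l').
    rewrite big_cat; split=> // p.
    by rewrite mem_cat => /orP[/lX|/lX'].
  - move=> a _ [l [lX <-]]; exists [seq (a * p.1, p.2) | p <- l]; split.
      by move=> _ /mapP[p /lX Xp2 ->].
    by rewrite big_map mulr_sumr; apply: eq_bigr => p _; rewrite mulrA.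
  - move=> p; have [x Xx px] := Xp p; exists x => //; exists [:: (1, x)].
    by rewrite big_seq1 mul1r; split=> // q; rewrite inE => /eqP ->.
exists (size l), (fun i => (tnth (in_tuple l) i).2).
exists (fun i => (tnth (in_tuple l) i).1).
split=> [i|]; first by apply: lX; exact: mem_tnth.
rewrite -l1 (big_tnth _ _ l); reflexivity.
Qed.

(** The image of [Spec S_l] is open, so each of its points has a neighbourhood [D(a)] inside it, and
    finitely many of these cover [Spec S_l] by quasi-compactness. *)
Lemma affine_open_cover_principal (R : comPzRingType) (n : nat)
    (S : 'I_n -> comPzRingType) (f : forall l, {rmorphism R -> S l}) :
  affine_open_covering f ->
  exists (m : 'I_n -> nat) (r : forall l, 'I_(m l) -> R),
  [/\ forall l i, bijective (@loc_map R (S l) (f l) (r l i)),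
      forall l, exists s, \sum_i s i * f l (r l i) = 1 &
      exists s, \sum_(i : {l : 'I_n & 'I_(m l)}) s i * r (tag i) (tagged i) = 1].
Proof.
move=> [fo fcov].
have cover l : exists m (r : 'I_m -> R),
    (forall i, distinguished (r i) `<=` range (spec_map (f l))) /\
    exists s, \sum_i s i * f l (r i) = 1.
  pose X : set (S l) := [set x | exists2 a,
    distinguished a `<=` range (spec_map (f l)) & f l a = x].
  have [|m [x [s [xX e]]]] := @set_unit_ideal _ X.
    move=> q; have [_ _ /(_ setT openT) fT _] := fo l.
    have [|a [aq aT]] := fT (spec_map (f l) q); first by exists q.
    by exists (f l a) => //; exists a.
  pose r i := projT1 (cid2 (xX i)).
  have rP i : distinguished (r i) `<=` range (spec_map (f l)) /\ f l (r i) = x i.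
    by rewrite /r; case: cid2.
  exists m, r; split=> [i|]; first exact: (rP i).1.
  by exists s; rewrite -[RHS]e; apply: eq_bigr => i _; rewrite (rP i).2.
pose m l := projT1 (cid (cover l)).
pose r l := cid (projT2 (cid (cover l))).
exists m, (fun l => projT1 (r l)).
have rP l := projT2 (r l).
split=> [l i|l|].
- by have [_ _ _] := fo l; apply; exact: (rP l).1.
- exact: (rP l).2.
apply: fin_unit_ideal => p.
have : (\bigcup_(l in [set: 'I_n]) range (spec_map (f l))) p by rewrite fcov.
move=> [l _ [q _ qp]]; apply: contrapT => noi.
(* If [p] contained all [r l i], the prime [q] of [S l] above it would contain all [f l (r l i)],
   which generate the unit ideal. *)
have [_ qD qM q1 _] := spec_prime q; apply: q1.
have [s <-] := (rP l).2; apply: big_ind => //; first by case: (spec_prime q).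
move=> i _; apply: qM; apply: contrapT => qi; apply: noi.
by exists (Tagged (fun l => 'I_(m l)) i); rewrite -qp.
Qed.

(** * Gluing operators *)

Section Order.
Variables (K R : comPzRingType) (k : {rmorphism K -> R}) (U V : lmodType R).

Lemma base_linear_additive (e : U -> V) : base_linear k e -> zmod_morphism e.
Proof.
move=> el u v; have := el (-1) v u.
by rewrite rmorphN1 !scaleN1r addrC => ->; rewrite addrC.
Qed.

Lemma bracket_base_linear (e : U -> V) r :
  base_linear k e -> base_linear k (bracket r e).
Proof.
move=> el c u v; rewrite /bracket scalerDr scalerA mulrC -scalerA !el.
by rewrite scalerDr scalerBr !scalerA mulrC opprD addrACA.
Qed.

Variables (d : Order.disp_t) (W : orderType d).
Hypothesis W_wf : well_founded (fun x y : W => (x < y)%O).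

Lemma diffop_filt_le a b (e : U -> V) : (a <= b)%O ->
  diffop_filt k W_wf a e -> diffop_filt k W_wf b e.
Proof.
move=> ab /diffop_filtE[el H]; apply/diffop_filtE; split=> // r.
case: (H r) => [|[c ca ce]]; first by left.
by right; exists c => //; exact: lt_le_trans ab.
Qed.

Lemma diffop_filt_zero a (e : U -> V) :
  (forall u, e u = 0) -> diffop_filt k W_wf a e.
Proof.
move=> e0; apply/diffop_filtE; split=> [c u v|r].
  by rewrite !e0 scaler0 addr0.
by left=> u; rewrite /bracket !e0 scaler0 subr0.
Qed.
End Order.

(** Transfinite induction on [a], for all [e] and [D] at once: the bracket of [e] with [r] is
    related to the brackets of the [D l] with [f l r] as [e] is to the [D l]. *)
Lemma diffop_filt_of_cover (K R : comPzRingType) (k : {rmorphism K -> R})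
    (n : nat) (S : 'I_n -> comPzRingType) (f : forall l, {rmorphism R -> S l})
    (U V : lmodType R)
    (U_gen : forall P : set U, P 0 -> (forall u v, P u -> P v -> P (u + v)) ->
       (forall l (g : homR (f l) U), P (g 1)) -> forall u, P u)
    (d : Order.disp_t) (W : orderType d)
    (W_wf : well_founded (fun x y : W => (x < y)%O)) (a : W)
    (e : U -> V) (D : forall l, homR (f l) U -> homR (f l) V) :
  base_linear k e -> (forall l, diffop_filt (f l \o k) W_wf a (D l)) ->
  (forall l (g : homR (f l) U), e (g 1) = D l g 1) -> diffop_filt k W_wf a e.
Proof.
elim/(well_founded_ind W_wf): a e D => a IH e D el DF De.
apply/diffop_filtE; split=> // r.
have Db l : (forall u, bracket (f l r) (D l) u = 0) \/
    exists2 b, (b < a)%O &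
      diffop_filt (f l \o k) W_wf b (bracket (f l r) (D l)).
  by have /diffop_filtE[_] := DF l; exact.
have eb l (g : homR (f l) U) : bracket r e (g 1) = bracket (f l r) (D l) g 1.
  rewrite /bracket -[RHS]/((f l r *: D l g) 1 - D l (f l r *: g) 1).
  by rewrite -De !hom_scaleE !homZ De.
have eblin := bracket_base_linear r el.
have eadd := base_linear_additive eblin.
(* Simultaneous vanishing is treated apart, since there may be no [b] below [a]. *)
case: (pselect (forall l u, bracket (f l r) (D l) u = 0)) => [all0|not_all0].
  left; apply: U_gen => [|u v eu ev|l g].
  - by rewrite -(subrr 0) eadd subrr.
  - have e0 : bracket r e 0 = 0 by rewrite -(subrr 0) eadd subrr.
    by rewrite -[v]opprK -[- v]sub0r !eadd e0 eu ev !subr0.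
  - by rewrite eb all0.
right.
(* As the covering is finite, the orders of the brackets have a maximum, still below [a]; a zero
   bracket is assigned the order [b0]. *)
have [b ba bF] : exists2 b, (b < a)%O & forall l,
    l \in enum 'I_n -> diffop_filt (f l \o k) W_wf b (bracket (f l r) (D l)).
  have [b0 b0a] : exists b0, (b0 < a)%O.
    apply: contrapT => nob; apply: not_all0 => l; case: (Db l) => // -[b ba _].
    by case: nob; exists b.
  elim: (enum 'I_n) => [|l s [b ba bF]]; first by exists b0.
  have [c ca cF] : exists2 c, (c < a)%O &
      diffop_filt (f l \o k) W_wf c (bracket (f l r) (D l)).
    by case: (Db l) => // z; exists b0 => //; exact: diffop_filt_zero.
  exists (Order.max b c); first by rewrite gt_max ba ca.
  move=> l'; rewrite inE => /orP[/eqP ->|/bF].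
    by apply: diffop_filt_le cF; rewrite le_max lexx orbT.
  by apply: diffop_filt_le; rewrite le_max lexx.
exists b => //; apply: (IH b ba _ (fun l => bracket (f l r) (D l))) => // l.
by apply: bF; rewrite mem_enum.
Qed.

(** The maps [a] and [b] factor through the tensor products of [S j] and [S l] in either order,
    where the operators [DD j l] and [DD l j] compute both sides and agree up to the swap. *)
Lemma overlap_compat (K R : comPzRingType) (k : {rmorphism K -> R})
    (n : nat) (S : 'I_n -> comPzRingType) (f : forall l, {rmorphism R -> S l})
    (U V : lmodType R)
    (D : forall l, homR (f l) U -> homR (f l) V)
    (DD : forall j l,
       homR (tensl (f j) (f l) \o f j) U -> homR (tensl (f j) (f l) \o f j) V)
    (DD_induced : forall j l,
       induced_tower k (f j) (tensl (f j) (f l)) (D j) (DD j l))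
    (DD_swap : forall j l (h : homR (tensl (f l) (f j) \o f l) U),
       DD j l (hom_swap (f j) (f l) h) = hom_swap (f j) (f l) (DD l j h))
    (C : comPzRingType) (q : {rmorphism R -> C}) j l
    (a : {rmorphism S j -> C}) (b : {rmorphism S l -> C})
    (aP : forall x, a (f j x) = q x) (bP : forall x, b (f l x) = q x)
    (h : homR q U) :
  D j (hom_pull aP h) 1 = D l (hom_pull bP h) 1.
Proof.
have [m mE] := tens_lift_rmorphism aP bP.
have [m' mE'] := tens_lift_rmorphism bP aP.
have mP x : m ((tensl (f j) (f l) \o f j) x) = q x.
  by rewrite /= /tensl mE aP rmorph1 mulr1.
have mP' x : m' ((tensl (f l) (f j) \o f l) x) = q x.
  by rewrite /= /tensl mE' bP rmorph1 mulr1.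
have Dpull i i' (c : {rmorphism S i -> C}) (cP : forall x, c (f i x) = q x)
    (t : {rmorphism tens (f i) (f i') -> C})
    (tP : forall x, t ((tensl (f i) (f i') \o f i) x) = q x) :
    (forall x, t (tensl (f i) (f i') x) = c x) ->
    D i (hom_pull cP h) 1 = DD i i' (hom_pull tP h) 1.
  move=> tc; have [_ /(_ (hom_curry (hom_pull tP h)))] := DD_induced i i'.
  rewrite hom_curryK => /(congr1 (fun g : homR (f i) V => g 1)).
  rewrite hom_curryE rmorph1 mulr1 => ->; congr (D i _ 1).
  by apply: homP => x; rewrite hom_curryE /= mulr1 tc.
rewrite (Dpull _ _ _ aP _ mP) => [|x]; last by rewrite /tensl mE rmorph1 mulr1.
rewrite (Dpull _ _ _ bP _ mP') => [|x]; last by rewrite /tensl mE' rmorph1 mulr1.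
have -> : hom_pull mP h = hom_swap (f j) (f l) (hom_pull mP' h).
  apply: homP; elim/tsum_ind=> x.
  rewrite -[RHS]/(h (m' (@tens_swap _ _ _ (f j) (f l) (tsum _ _ x)))) [LHS]/=.
  rewrite tsumE (raddf_sum (@tens_swap _ _ _ (f j) (f l))) !raddf_sum.
  congr (hom_fun h _); apply: eq_bigr => p _.
  rewrite -[RHS]/(m' (@tens_swap _ _ _ (f j) (f l) (pure _ _ p.1 p.2))).
  by rewrite tens_swapE mE' mulrC; exact: mE.
by rewrite DD_swap /= rmorph1.
Qed.

Section Gluing.
Variables (K R : comPzRingType) (k : {rmorphism K -> R}) (n : nat).
Variables (S : 'I_n -> comPzRingType) (f : forall l, {rmorphism R -> S l}).
Variables (U V : lmodType R) (D : forall l, homR (f l) U -> homR (f l) V).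
Hypothesis U_contra : contraadjusted U.
Hypothesis D_lin : forall l, base_linear (f l \o k) (@D l).
Variables (I : finType) (lam : I -> 'I_n) (r s : I -> R).
Variable g : forall i, {rmorphism S (lam i) -> loc (r i)}.
Hypothesis gf : forall i a, g i (f (lam i) a) = loc_inj (r i) a.
Hypothesis unit_ideal : \sum_i s i * r i = 1.
Hypothesis D_compat : forall (C : comPzRingType) (q : {rmorphism R -> C}) j l
    (a : {rmorphism S j -> C}) (b : {rmorphism S l -> C})
    (aP : forall x, a (f j x) = q x) (bP : forall x, b (f l x) = q x)
    (h : homR q U),
  D (hom_pull aP h) 1 = D (hom_pull bP h) 1.

Notation A i := (homR (@loc_inj R (r i)) U).
Notation pull i h := (@hom_pull _ _ _ _ _ (g i) (gf i) U h).

Let DV l (phi : homR (f l) U) : V := D phi 1.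
Let DV_zmod l : zmod_morphism (@DV l).
Proof. by move=> u v; rewrite /DV (base_linear_additive (D_lin (l:=l))). Qed.
HB.instance Definition _ l := GRing.isZmodMorphism.Build _ V (@DV l) (@DV_zmod l).

(** The operator is first a relation, as a decomposition of [u] over the colocalizations is not
    unique. *)
Definition glue_graph (u : U) (v : V) : Prop := exists h : forall i, A i,
  u = \sum_i h i 1 /\ v = \sum_i D (pull i (h i)) 1.

Lemma glue_graph_total u : exists v, glue_graph u v.
Proof.
have solve x : solvable U x by move=> c; exact: contraadjusted_solve.
have [w [wr ->]] := divseq_cover_surj solve unit_ideal u.
pose h i := projT1 (cid (loc_hom_of_divseq (wr i))).
exists (\sum_i D (pull i (h i)) 1), h; split=> //; apply: eq_bigr => i _.
by rewrite -(projT2 (cid (loc_hom_of_divseq (wr i))) 0%N).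
Qed.

Lemma glue_graph_linear (c : K) u v u' v' : glue_graph u v -> glue_graph u' v' ->
  glue_graph (k c *: u + u') (k c *: v + v').
Proof.
move=> [h [-> ->]] [h' [-> ->]].
exists (fun i => loc_inj (r i) (k c) *: h i + h' i).
rewrite !scaler_sumr -!big_split; split; apply: eq_bigr => i _.
  by rewrite hom_addE hom_scaleE homZ.
have -> : pull i (loc_inj (r i) (k c) *: h i + h' i) =
    (f (lam i) \o k) c *: pull i (h i) + pull i (h' i).
  by apply: homP => t; rewrite /= rmorphM gf.
by rewrite D_lin hom_addE hom_scaleE homZ.
Qed.

(** By exactness of the Cech complex the family [h] comes from elements [W i j] on double overlaps.
    Each of them contributes through [D (lam i)] and, with the opposite sign, through [D (lam j)],
    and [D_compat] cancels the two. *)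
Lemma glue_graph0 v : glue_graph 0 v -> v = 0.
Proof.
move=> [h [h0 ->]].
have solve x : solvable U x by move=> c; exact: contraadjusted_solve.
have [w [wr hw]] := divseq_cover_exact solve unit_ideal
  (fun i => divseq_of_loc_hom (h i)) (esym h0).
pose W i j := projT1 (cid (loc_hom_of_divseq (wr i j))).
have WE i j m : W i j (frac (r i * r j) 1 m) = w i j m.
  exact: (projT2 (cid (loc_hom_of_divseq (wr i j)))).
(* The inverse of [r_i] is [r_j / (r_i r_j)]. Both orders of the product occur because
   [loc (r i * r j)] and [loc (r j * r i)] are different types. *)
have invl i j : loc_inj (r i * r j) (r i) * frac (r i * r j) (r j) 1 = 1.
  rewrite /loc_inj fracM -[RHS]/(frac _ 1 0); apply/fracP; exists 0%N.
  by rewrite mulr1 mul1r expr1.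
have invr i j : loc_inj (r j * r i) (r i) * frac (r j * r i) (r j) 1 = 1.
  rewrite /loc_inj fracM -[RHS]/(frac _ 1 0); apply/fracP; exists 0%N.
  by rewrite mulr1 mul1r expr1 mulrC.
pose gl i j := projT1 (cid (loc_lift (invl i j))).
pose gr i j := projT1 (cid (loc_lift (invr i j))).
have glE i j a m : gl i j (frac (r i) a m) = frac (r i * r j) (a * r j ^+ m) m.
  rewrite (projT2 (cid (loc_lift (invl i j)))).
  elim: m => [|m IH]; first by rewrite !expr0 !mulr1.
  by rewrite exprSr mulrA IH fracM addn1 exprSr mulrA.
have grE i j a m : gr i j (frac (r i) a m) = frac (r j * r i) (a * r j ^+ m) m.
  rewrite (projT2 (cid (loc_lift (invr i j)))).
  elim: m => [|m IH]; first by rewrite !expr0 !mulr1.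
  by rewrite exprSr mulrA IH fracM addn1 exprSr mulrA.
have glP i j a : (gl i j \o g i) (f (lam i) a) = loc_inj (r i * r j) a.
  by rewrite /= gf /loc_inj glE mulr1.
have grP i j a : (gr i j \o g i) (f (lam i) a) = loc_inj (r j * r i) a.
  by rewrite /= gf /loc_inj grE mulr1.
have hE i : pull i (h i) =
    \sum_j hom_pull (glP i j) (W i j) - \sum_j hom_pull (grP i j) (W j i).
  apply: homP => t; rewrite -[RHS]/((\sum_j hom_pull (glP i j) (W i j)) t -
    (\sum_j hom_pull (grP i j) (W j i)) t) !hom_sumE /=.
  elim/loc_ind: (g i t) => a m; rewrite loc_hom_frac hw scalerBr !scaler_sumr.
  congr (_ - _); apply: eq_bigr => j _.
    by rewrite glE loc_hom_frac WE scalerA.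
  by rewrite grE loc_hom_frac WE scalerA.
pose X i j : V := D (hom_pull (glP i j) (W i j)) 1.
pose Y i j : V := D (hom_pull (grP i j) (W j i)) 1.
have DE i : D (pull i (h i)) 1 = \sum_j X i j - \sum_j Y i j.
  rewrite hE -[LHS]/(DV _) raddfB; congr (_ - _); exact: raddf_sum.
rewrite (eq_bigr _ (fun i _ => DE i)) sumrB [X in _ - X]exchange_big -sumrB.
rewrite big1 // => i _.
rewrite -sumrB big1 // => j _; apply/eqP; rewrite subr_eq0; apply/eqP.
exact: D_compat.
Qed.

Lemma glue_exists : exists2 e : U -> V, base_linear k e &
  forall i (h : A i), e (h 1) = D (pull i h) 1.
Proof.
have [e eP] := choice glue_graph_total.
(* Linearity with coefficient [-1] reduces single-valuedness to [glue_graph0]. *)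
have eU u v : glue_graph u v -> e u = v.
  move=> uv; apply/eqP; rewrite -subr_eq0 -oppr_eq0 opprB; apply/eqP/glue_graph0.
  have := glue_graph_linear (-1) (eP u) uv.
  by rewrite rmorphN1 !scaleN1r addNr addrC.
exists e => [c u v|i h]; first by apply/eU/glue_graph_linear.
apply: eU; have [h' [h'i h'0]] := @dep_delta I (fun i => A i) i h.
exists h'; split; rewrite (bigD1 i) //= h'i big1 ?addr0 // => j ji;
  rewrite h'0 //.
rewrite -[D _ 1]/(DV _) (_ : pull j 0 = 0) ?raddf0 //.
exact: homP.
Qed.
End Gluing.

Theorem proposition7p7
  (K R : comPzRingType) (k : {rmorphism K -> R})
  (n : nat) (S : 'I_n -> comPzRingType) (f : forall l, {rmorphism R -> S l})
  (fcov : affine_open_covering f)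
  (alpha : Ord) (U V : lmodType R) (U_contra : contraadjusted U)
  (D : forall l, homR (f l) U -> homR (f l) V)
  (D_quite : forall l, quite_diffop_le (f l \o k) alpha (D l))
  (DD : forall j l,
     homR (tensl (f j) (f l) \o f j) U -> homR (tensl (f j) (f l) \o f j) V)
  (DD_induced : forall j l,
     induced_tower k (f j) (tensl (f j) (f l)) (D j) (DD j l))
  (DD_swap : forall j l (h : homR (tensl (f l) (f j) \o f l) U),
     DD j l (hom_swap (f j) (f l) h) = hom_swap (f j) (f l) (DD l j h)) :
  exists! D0 : U -> V,
    quite_diffop_le k alpha D0 /\ forall l, induced k (f l) D0 (D l).
Proof.
have [m [r [bij unitS [s sE]]]] := affine_open_cover_principal fcov.
have Dlin l : base_linear (f l \o k) (D l) by have /diffop_filtE[] := D_quite l.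
pose lift l i := cid (loc_map_bij_lift (bij l i)).
pose g l i : {rmorphism S l -> loc (r l i)} := projT1 (lift l i).
have gf l i a : g l i (f l a) = loc_inj (r l i) a.
  by have [] := projT2 (lift l i).
have g_num l i t : exists p a, f l (r l i) ^+ p * t = f l a.
  by have [] := projT2 (lift l i).
have [e elin eE] := @glue_exists _ _ k _ _ f U V D U_contra Dlin _ _ _ s
  (fun i : {l : 'I_n & 'I_(m l)} => g (tag i) (tagged i))
  (fun i => gf (tag i) (tagged i)) sE (overlap_compat DD_induced DD_swap).
have eadd := base_linear_additive elin.
pose eA : {additive U -> V} := HB.pack_for {additive U -> V} e
  (GRing.isZmodMorphism.Build U V e eadd).
(* By [eE], [e] is known on homomorphisms from the [R[r_i^-1]]; these generate [Hom_R(S_l, U)], and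
   both sides are additive. *)
have eD l (phi : homR (f l) U) : e (phi 1) = D l phi 1.
  have [sl slE] := unitS l.
  have [h ->] := hom_cover_surj (gf l) (g_num l) (bij l) slE U_contra phi.
  pose DV (psi : homR (f l) U) := D l psi 1.
  have DVz : zmod_morphism DV.
    by move=> x y; rewrite /DV (base_linear_additive (Dlin l)).
  pose DA : {additive homR (f l) U -> V} :=
    HB.pack_for {additive homR (f l) U -> V} DV
      (GRing.isZmodMorphism.Build _ V DV DVz).
  rewrite -[RHS]/(DA _) hom_sumE -[LHS]/(eA _) !raddf_sum; apply: eq_bigr => i _.
  rewrite -[RHS](eE (Tagged (fun l => 'I_(m l)) i)) /= /DV rmorph1.
  exact: erefl.
(* The values [phi 1] generate [U] additively; both the bound on the order and uniqueness are
   checked on them. *)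
have gen (P : set U) : P 0 -> (forall u v, P u -> P v -> P (u + v)) ->
    (forall l (phi : homR (f l) U), P (phi 1)) -> forall u, P u.
  move=> P0 PD P1 u.
  have solve x : solvable U x by move=> c; exact: contraadjusted_solve.
  have [w [wr ->]] := divseq_cover_surj solve sE u.
  apply: big_ind => // i _; have [h hE] := loc_hom_of_divseq (wr i).
  have := P1 _ (hom_pull (gf (tag i) (tagged i)) h).
  by rewrite /= rmorph1 -[1]/(frac _ 1 0) hE.
exists e; split=> [|e' [e'q e'D]]; first split.
- exact: diffop_filt_of_cover D_quite eD.
- by move=> l; split=> [|phi]; [exists alpha; exact: D_quite|rewrite eD].
have e'add : zmod_morphism e'.
  by have /diffop_filtE[/base_linear_additive] := e'q.
pose eA' : {additive U -> V} := HB.pack_for {additive U -> V} e'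
  (GRing.isZmodMorphism.Build U V e' e'add).
apply/funext; apply: gen => [|u v eu ev|l phi].
- by rewrite -[LHS]/(eA 0) -[RHS]/(eA' 0) !raddf0.
- by rewrite -[LHS]/(eA _) -[RHS]/(eA' _) !raddfD /= eu ev.
- by rewrite eD; have [_ ->] := e'D l.
Qed.
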